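(* For every integer $n\geq 8$, $\Pi(n)\geq \left\lceil \frac{5}{84}(n-2)\right\rceil$. That is, for every simple polygon $P$ and every set $S$ of $n$ points of $P$ in general position, there exist $u,v\in S$ such that every geodesic disk through $u$ and $v$ contains at least $\left\lceil \frac{5}{84}(n-2)\right\rceil$ points of $S$.
   Context: $P$ is a simple polygon (a closed region). For $a,b\in P$, $g(a,b)$ denotes the shortest (geodesic) path from $a$ to $b$ inside $P$ and $|g(a,b)|$ its length. A geodesic disk with center $c$ and radius $r$ is $D(c,r)=\{x\in P:|g(c,x)|\le r\}$; it is ''through'' some points if those points lie on its boundary (distance exactly $r$ from $c$), and contains a point if the point belongs to it. General position of $S$: no three points of $S$ are geodesically collinear (one on the geodesic path between the other two), no four points among $S$ and the vertices of $P$ lie on the boundary of a common geodesic disk, there are no $x,y\in S$ and reflex vertex $p$ of $P$ with $y\in g(x,p)$, and no geodesic bisector (set of points equidistant from two points) of two points of $S$ passes through a vertex of $P$. $\Pi(n)$ is the largest integer such that for every simple polygon $P$ and every set $S$ of $n$ points of $P$ in general position, there exist $u,v\in S$ such that every geodesic disk through $u$ and $v$ contains at least $\Pi(n)$ points of $S$. *)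

(* Defs.v *)
From HB Require Import structures.
From mathcomp Require Import all_boot all_order all_algebra.
From mathcomp Require Import all_classical all_reals all_analysis.
Import numFieldNormedType.Exports.
Set Implicit Arguments. Unset Strict Implicit. Unset Printing Implicit Defensive.
Import Order.TTheory GRing.Theory Num.Theory.
Local Open Scope classical_set_scope.
Local Open Scope ring_scope.

Notation pt R := (R * R)%type.

Section Geo.
Variable R : realType.

Definition pt0 : pt R := (0, 0).

Definition edist (p q : pt R) : R :=
  Num.sqrt ((p.1 - q.1) ^+ 2 + (p.2 - q.2) ^+ 2).

Definition seg (p q : pt R) : set (pt R) :=
  [set z | exists2 t : R, 0 <= t <= 1 &
     z = ((1 - t) * p.1 + t * q.1, (1 - t) * p.2 + t * q.2)].

Definition cross (u v : pt R) : R := u.1 * v.2 - u.2 * v.1.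
Definition vsub (p q : pt R) : pt R := (p.1 - q.1, p.2 - q.2).

(* a polygon is given by the cyclic list of its vertices *)
Definition vtx (vs : seq (pt R)) (i : nat) : pt R := nth pt0 vs (i %% size vs)%N.
Definition edge (vs : seq (pt R)) (i : nat) : set (pt R) :=
  seg (vtx vs i) (vtx vs i.+1).

Definition simple_polygon (vs : seq (pt R)) : Prop :=
  [/\ (3 <= size vs)%N, uniq vs &
   forall i j, (i < size vs)%N -> (j < size vs)%N -> i != j ->
     if j == (i.+1 %% size vs)%N then edge vs i `&` edge vs j = [set vtx vs j]
     else if i == (j.+1 %% size vs)%N then edge vs i `&` edge vs j = [set vtx vs i]
     else edge vs i `&` edge vs j = set0].

Definition pboundary (vs : seq (pt R)) : set (pt R) :=
  \bigcup_(i in [set i : nat | (i < size vs)%N]) edge vs i.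

Definition bounded2 (A : set (pt R)) : Prop :=
  exists M : R, forall p, A p -> `|p.1| <= M /\ `|p.2| <= M.

Definition region (vs : seq (pt R)) : set (pt R) :=
  [set x | pboundary vs x \/
           (~ pboundary vs x /\
            bounded2 (connected_component (~` pboundary vs) x))].

Fixpoint chain_in (P : set (pt R)) (a : pt R) (t : seq (pt R)) : Prop :=
  match t with
  | [::] => True
  | b :: t' => seg a b `<=` P /\ chain_in P b t'
  end.

Fixpoint chain_len (a : pt R) (t : seq (pt R)) : R :=
  match t with
  | [::] => 0
  | b :: t' => edist a b + chain_len b t'
  end.

Definition gdist (P : set (pt R)) (a b : pt R) : R :=
  inf [set l : R | exists t : seq (pt R),
         chain_in P a (rcons t b) /\ l = chain_len a (rcons t b)].

(* twice the signed area of the polygon (positive iff counterclockwise) *)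
Definition area2 (vs : seq (pt R)) : R :=
  \sum_(i < size vs) cross (vtx vs i) (vtx vs i.+1).

(* reflex vertex: interior angle > pi *)
Definition reflex_vertex (vs : seq (pt R)) (p : pt R) : Prop :=
  exists2 i : nat, (i < size vs)%N & p = vtx vs i /\
    cross (vsub (vtx vs i) (vtx vs (i + size vs).-1%N))
          (vsub (vtx vs i.+1) (vtx vs i)) * area2 vs < 0.

Definition on_geodesic (P : set (pt R)) (x y z : pt R) : Prop :=
  gdist P x y + gdist P y z = gdist P x z.

Definition general_position (vs : seq (pt R)) (S : seq (pt R)) : Prop :=
  let P := region vs in
  [/\
      (forall x y z, x \in S -> y \in S -> z \in S ->
         uniq [:: x; y; z] -> ~ on_geodesic P x y z),
      (forall a b c d, uniq [:: a; b; c; d] ->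
         all (fun q => q \in S ++ vs) [:: a; b; c; d] ->
         forall (c0 : pt R) (r : R), P c0 ->
         ~ [/\ gdist P c0 a = r, gdist P c0 b = r, gdist P c0 c = r
             & gdist P c0 d = r]),
      (forall x y p, x \in S -> y \in S -> x != y -> reflex_vertex vs p ->
         ~ on_geodesic P x y p) &
      (* no geodesic bisector of two points of S passes through a vertex *)
      (forall x y p, x \in S -> y \in S -> x != y -> p \in vs ->
         gdist P x p != gdist P y p)].

End Geo.

(* Main.v *)
(* Call a pair of sites in a set [V] a Delaunay pair if some geodesic disk
   through it contains no other site of [V]. Joining each site of such a pair to
   the centre by a nearly shortest path draws the Delaunay graph in the plane so
   that independent edges are disjoint: at a common point, the site nearer to
   that point would lie in the disk of the other edge. Such graphs form a
   minor-closed class that omits K5, so by Mader's argument they have at most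
   3|V| - 6 edges. Hence among 8 sites at least 28 - 18 = 10 pairs have a further
   site in each of their disks; averaging over the 8-subsets of S yields a pair
   each of whose disks contains at least 10/(6 * 28) (n - 2) = 5/84 (n - 2) other
   sites. *)
From mathcomp Require Import all_boot zify.
Set Implicit Arguments. Unset Strict Implicit. Unset Printing Implicit Defensive.

(** * Edge bound for minor-closed classes without K5 *)

(** Only independent edges can be kept disjoint: half-edges leading from different centres to the
    same site may cross. The drawing is therefore no embedding and has no faces to count, so K5 is
    excluded by a parity argument that looks at independent pairs alone, and the edge bound rests on
    minors instead of Euler's formula. An edge is recorded as a set of points in which its ends are
    polygonally connected, so that an edge rerouted by a contraction is just a union of two such
    sets. Distances are infima and no shortest path is ever constructed; the strict gap between the
    radius of an empty disk and the nearest other site leaves room for chains that are only nearly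
    shortest. In the averaging one disk per pair is enough: were the conclusion false, each pair
    would have a disk with too few sites, and a pair that is not Delaunay in an 8-subset has a
    further site of that subset in this particular disk. *)

Section Graphs.
Variable T : finType.
Implicit Types (V : {set T}) (E : rel T).

(** Arcs are ordered pairs, so each edge counts twice and the bound 3|V| - 6 reads 6|V| - 12. *)
Definition arcs V E : {set T * T} :=
  [set p | [&& p.1 \in V, p.2 \in V, p.1 != p.2 & E p.1 p.2]].

Definition nbrs V E x : {set T} := [set v in V | (v != x) && E x v].

(** The merged vertex keeps the name [x]; [y] disappears only on passing to [V :\ y]. *)
Definition contract_edge E x y : rel T := fun u v =>
  (u != v) && [|| E u v, (u == x) && E y v | (v == x) && E u y].

Definition delete_edge E x y : rel T := fun u v =>
  E u v && ((u, v) \notin [set (x, y); (y, x)]).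

Lemma in_arcs V E u v :
  ((u, v) \in arcs V E) = [&& u \in V, v \in V, u != v & E u v].
Proof. by rewrite inE. Qed.

Lemma contract_edge_sym E x y : symmetric E -> symmetric (contract_edge E x y).
Proof.
move=> sE u v; rewrite /contract_edge eq_sym (sE u v) (sE y v) (sE u y).
by case: (E v u); case: (E v y); case: (E y u); case: (u == x); case: (v == x).
Qed.

Lemma delete_edge_sym E x y : symmetric E -> symmetric (delete_edge E x y).
Proof.
move=> sE u v; rewrite /delete_edge sE !inE !xpair_eqE.
by rewrite orbC [(v == y) && _]andbC [(v == x) && _]andbC.
Qed.

Lemma card_arcs_sum V E : #|arcs V E| = \sum_(u in V) #|nbrs V E u|.
Proof.
rewrite -sum1_card [LHS](partition_big fst (mem V)) /=; last first.
  by move=> [u v]; rewrite in_arcs => /andP[].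
apply: eq_bigr => u uV; rewrite -sum1_card.
rewrite (reindex_onto (pair u) snd) /=; last first.
  by move=> [a b] /andP[_ /eqP <-].
apply: eq_bigl => v; rewrite in_arcs !inE uV !eqxx !andbT /=.
by rewrite eq_sym.
Qed.

Lemma card_arcs_compl V E :
  #|arcs V E| + #|arcs V (fun u v => ~~ E u v)| = #|V| * #|V|.-1.
Proof.
rewrite !card_arcs_sum -big_split /= -sum_nat_const; apply: eq_bigr => u uV.
have -> : #|V|.-1 = #|V :\ u| by rewrite (cardsD1 u V) uV.
rewrite -(cardsID [set v | E u v] (V :\ u)); congr (_ + _); apply: eq_card => v.
  by rewrite !inE; case: (v \in V); case: (v != u).
by rewrite !inE; case: (v \in V); case: (v != u); rewrite ?andbF ?andbT.
Qed.

Lemma card_arcs_le V E : #|arcs V E| <= #|V| * #|V|.-1.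
Proof. by rewrite -(card_arcs_compl V E) leq_addr. Qed.

Lemma card_arcs_remove V E x : symmetric E ->
  #|arcs V E| <= #|arcs (V :\ x) E| + 2 * #|nbrs V E x|.
Proof.
move=> sE; rewrite mul2n -addnn addnA.
set N := nbrs V E x.
have sub : arcs V E \subset arcs (V :\ x) E :|: pair x @: N :|: pair^~ x @: N.
  apply/subsetP=> -[u v]; rewrite !in_setU !in_arcs => /and4P[uV vV uv Euv].
  rewrite !in_setD1 uV vV uv Euv !andbT /=.
  have [eu|/= ux] := eqVneq u x.
    have -> // : (u, v) \in pair x @: N.
    by rewrite eu; apply: imset_f; rewrite inE vV -eu Euv eq_sym uv.
  have [ev|//] := eqVneq v x.
  have -> // : (u, v) \in pair^~ x @: N; last by rewrite orbT.
  by rewrite ev; apply: imset_f; rewrite inE uV -ev uv sE.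
apply: leq_trans (subset_leq_card sub) _.
by rewrite (leq_trans (leq_card_setU _ _)) // leq_add ?leq_imset_card //
  (leq_trans (leq_card_setU _ _)) // leq_add ?leq_imset_card.
Qed.

(** Contraction loses the edge xy and one edge per common neighbour, where two edges merge; the
    remaining neighbours [Q] of [y] give new edges at [x]. *)
Lemma card_arcs_contract V E x y : symmetric E -> x \in V -> y \in V ->
  x != y -> E x y ->
  #|arcs V E| <= #|arcs (V :\ y) (contract_edge E x y)|
                  + 2 * #|nbrs V E x :&: nbrs V E y| + 2.
Proof.
move=> sE xV yV xy Exy.
apply: leq_trans (card_arcs_remove V y sE) _.
set C := nbrs V E x :&: nbrs V E y.
set Q := nbrs V E y :\: (x |: nbrs V E x).
have cN : #|nbrs V E y| = 1 + #|C| + #|Q|.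
  rewrite -(cardsID (x |: nbrs V E x) (nbrs V E y)); congr (_ + _).
  rewrite setIUr setIC [nbrs V E y :&: _]setIC -/C.
  rewrite (setIidPl _) ?cardsU1 ?sub1set; last by rewrite inE xV xy sE.
  by rewrite !inE eqxx andbF.
have sub : arcs (V :\ y) E :|: (pair x @: Q :|: pair^~ x @: Q)
   \subset arcs (V :\ y) (contract_edge E x y).
  apply/subsetP=> p; rewrite !in_setU => /or3P[].
  - case: p => u v; rewrite !in_arcs => /and4P[-> -> uv Euv] /=.
    by rewrite /contract_edge uv Euv.
  - case/imsetP=> v vQ ->; move: vQ => /setDP[].
    rewrite !inE negb_or => /and3P[vV vy Eyv] /andP[vx _].
    by rewrite /= xy xV vy vV /contract_edge eq_sym vx eqxx Eyv /= orbT.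
  - case/imsetP=> v vQ ->; move: vQ => /setDP[].
    rewrite !inE negb_or => /and3P[vV vy Eyv] /andP[vx _].
    by rewrite /= xy xV vy vV /contract_edge vx eqxx (sE v y) Eyv /= !orbT.
have disj1 : [disjoint pair x @: Q & pair^~ x @: Q].
  rewrite -setI_eq0; apply/eqP/setP=> p; rewrite in_setI in_set0.
  apply/negP=> /andP[/imsetP[v vQ ->] /imsetP[w _ [_ e]]].
  by move: vQ; rewrite e !inE eqxx.
have disj2 : [disjoint arcs (V :\ y) E & pair x @: Q :|: pair^~ x @: Q].
  rewrite -setI_eq0; apply/eqP/setP=> p; rewrite in_setI in_set0 in_setU.
  apply/negP=> /andP[pA /orP[]] /imsetP[v vQ e]; move: pA vQ;
    rewrite e /= in_arcs !inE negb_or => /and4P[_ _ ? Ev] /andP[/andP[vx]].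
    by move=> + /and3P[vV vy _]; rewrite vV vx Ev.
  by move=> + /and3P[vV vy _]; rewrite vV vx sE Ev.
move/subset_leq_card: sub.
rewrite cardsU (disjoint_setI0 disj2) cards0 subn0.
rewrite cardsU (disjoint_setI0 disj1) cards0 subn0.
rewrite !card_imset; [|by move=> u v []|by move=> u v []].
lia.
Qed.

Section Mader.
Variable D : {set T} -> rel T -> Prop.
Hypothesis D_sub : forall V V' E E', V' \subset V ->
  (forall u v, E' u v -> E u v) -> D V E -> D V' E'.
Hypothesis D_contract : forall V E x y, symmetric E ->
  x \in V -> y \in V -> x != y -> E x y ->
  D V E -> D (V :\ y) (contract_edge E x y).
Hypothesis D_K5 : forall V E, #|V| = 5 ->
  {in V &, forall u v, u != v -> E u v} -> ~ D V E.

(* A vertex of degree 5 all of whose edges lie in three triangles has a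
   neighbourhood missing at most a matching; contracting an edge between two
   missing pairs leaves K5. *)
Lemma degree5_K5 V E x : symmetric E -> x \in V -> #|nbrs V E x| = 5 ->
  {in nbrs V E x, forall w, 3 <= #|nbrs V E x :&: nbrs V E w|} -> ~ D V E.
Proof.
move=> sE xV; set N := nbrs V E x => cN tri DV.
have NV w : w \in N -> w \in V by rewrite inE => /andP[].
have Nx w : w \in N -> w != x by rewrite inE => /and3P[].
have EN w : w \in N -> E x w by rewrite inE => /and3P[].
have NE w z : w \in N -> z \in N -> (z \in nbrs V E w) = (z != w) && E w z.
  by move=> wN zN; rewrite inE NV.
(* By [tri], [w] is adjacent to at least three of the four other elements of [N], so it misses at
   most one. *)
have uniqn w z z' : w \in N -> z \in N -> z' \in N -> z != w -> z' != w ->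
    ~~ E w z -> ~~ E w z' -> z = z'.
  move=> wN zN z'N zw z'w nz nz'; apply/eqP/negPn/negP => zz'.
  have : N :&: nbrs V E w \subset N :\: [set w; z; z'].
    apply/subsetP=> t; rewrite in_setI => /andP[tN].
    rewrite NE // => /andP[tw Et]; rewrite in_setD tN !inE andbT.
    rewrite (negPf tw) /=; apply/negP=> /orP[/eqP e|/eqP e].
      by rewrite e (negPf nz) in Et.
    by rewrite e (negPf nz') in Et.
  have sN : [set w; z; z'] \subset N.
    by apply/subsetP=> t; rewrite !in_setU !in_set1 => /orP[/orP[]|] /eqP ->.
  move/subset_leq_card; rewrite cardsD (setIidPr sN) cN -setUA cardsU1 cards2.
  rewrite zz' !inE negb_or [w == z]eq_sym [w == z']eq_sym zw z'w /= => h.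
  by have := tri _ wN; lia.
case: (boolP [forall u in N, forall v in N, (u != v) ==> E u v]) => [h|].
  apply: (@D_K5 N E cN); last by apply: (D_sub _ _ DV) => //; apply/subsetP.
  move=> u v uN vN uv; move/forall_inP: h => /(_ _ uN) /forall_inP /(_ _ vN).
  by rewrite uv.
rewrite negb_forall_in => /exists_inP[a aN].
rewrite negb_forall_in => /exists_inP[b bN]; rewrite negb_imply => /andP[ab nab].
have nba : ~~ E b a by rewrite sE.
set W := N :\: [set a; b].
have cW : #|W| = 3.
  rewrite cardsD (setIidPr _) ?cN ?cards2 ?ab //.
  by apply/subsetP=> t; rewrite in_set2 => /orP[] /eqP ->.
have WN w : w \in W -> w \in N by rewrite in_setD => /andP[].
have Wab w : w \in W -> (w != a) && (w != b).
  by rewrite in_setD in_set2 negb_or => /andP[].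
have Ea w : w \in W -> E a w.
  move=> wW; apply/negPn/negP=> n; have /andP[wa wb] := Wab _ wW.
  have := uniqn a b w aN bN (WN _ wW) _ wa nab n.
  by rewrite eq_sym ab => /(_ isT) e; rewrite e eqxx in wb.
have Eb w : w \in W -> E b w.
  move=> wW; apply/negPn/negP=> n; have /andP[wa wb] := Wab _ wW.
  have := uniqn b a w bN aN (WN _ wW) ab wb nba n.
  by move=> e; rewrite e eqxx in wa.
have xN : x \notin N by rewrite inE eqxx andbF.
case: (boolP [forall u in W, forall v in W, (u != v) ==> E u v]) => [h|].
  have KW u v : u \in W -> v \in W -> u != v -> E u v.
    move=> uW vW uv; move/forall_inP: h => /(_ _ uW) /forall_inP /(_ _ vW).
    by rewrite uv.
  apply: (@D_K5 (x |: (a |: W)) E).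
  - have aW : a \notin W by rewrite in_setD in_set2 eqxx.
    have xW : x \notin W by rewrite in_setD (negPf xN) andbF.
    by rewrite !cardsU1 cW in_setU1 negb_or aW xW eq_sym Nx.
  - move=> u v; rewrite !in_setU1 => /or3P[/eqP->|/eqP->|uW] /or3P[/eqP->|/eqP->|vW] uv;
      try by rewrite eqxx in uv.
    + exact: EN.
    + exact: EN (WN _ vW).
    + by rewrite sE EN.
    + exact: Ea.
    + by rewrite sE EN ?WN.
    + by rewrite sE Ea.
    + exact: KW.
  - apply: (D_sub _ _ DV) => //; apply/subsetP=> t.
    by rewrite !in_setU1 => /or3P[/eqP->|/eqP->|/WN/NV] //; exact: NV.
rewrite negb_forall_in => /exists_inP[c cW'].
rewrite negb_forall_in => /exists_inP[d dW]; rewrite negb_imply => /andP[cd ncd].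
have /andP[ca cb] := Wab _ cW'; have /andP[da db] := Wab _ dW.
have [cNn dNn] := (WN _ cW', WN _ dW).
(* The missing pairs are ab and cd: the merged vertex is adjacent to [b] through [c] and to [d]
   through [a]. *)
have Dc := D_contract sE (NV _ aN) (NV _ cNn) _ (Ea _ cW') DV.
rewrite eq_sym in ca; move: {Dc}(Dc ca) => Dc.
have cin : c \in x |: N by rewrite in_setU1 cNn orbT.
apply: (@D_K5 ((x |: N) :\ c) (contract_edge E a c)); last 1 first.
- apply: (D_sub _ _ Dc) => //; apply: setSD; apply/subsetP=> t.
  by rewrite in_setU1 => /orP[/eqP->|/NV].
- by have := cardsD1 c (x |: N); rewrite cin cardsU1 xN cN !add1n => -[].
move=> u v; rewrite !in_setD1 !in_setU1 => /andP[uc uN] /andP[vc vN] uv.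
rewrite /contract_edge uv /=; case: (boolP (E u v)) => //= nuv.
have ux : u != x.
  apply/eqP=> e; case/orP: vN => [/eqP ev|/EN]; first by rewrite e ev eqxx in uv.
  by rewrite -e (negPf nuv).
have vx : v != x.
  apply/eqP=> e; case/orP: uN => [/eqP ev|/EN]; first by rewrite e ev eqxx in uv.
  by rewrite -e sE (negPf nuv).
rewrite (negPf ux) in uN; rewrite (negPf vx) in vN; rewrite /= in uN vN.
have nvu : ~~ E v u by rewrite sE.
have vu : v != u by rewrite eq_sym.
have Ecb : E c b by rewrite sE Eb.
have [ea|ua] := eqVneq u a.
  have -> : v = b; last by rewrite Ecb.
  by apply: (uniqn a); rewrite -?ea // ea // eq_sym.
have [ev|va] := eqVneq v a.
  have -> : u = b; last by rewrite [E b c]sE Ecb orbT.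
  by apply: (uniqn a); rewrite -?ev // ev // eq_sym.
(* A further missing pair would avoid [a], [b], [c] and [d], but only one element of [N] is left. *)
exfalso.
have [ub|ub] := eqVneq u b.
  by move/eqP: va; apply; apply: (uniqn b) => //; rewrite -ub.
have [vb|vb] := eqVneq v b.
  by move/eqP: ua; apply; apply: (uniqn b) => //; rewrite -vb.
have ndc : ~~ E d c by rewrite sE.
have [ud|ud] := eqVneq u d.
  by move/eqP: vc; apply; apply: (uniqn d) => //; rewrite -ud.
have [vd|vd] := eqVneq v d.
  by move/eqP: uc; apply; apply: (uniqn d) => //; rewrite -vd.
have /subset_leq_card : [set u; v] \subset W :\: [set c; d].
  apply/subsetP=> t /set2P[] ->; rewrite !in_setD !in_set2 !negb_or;
    by rewrite ?ua ?ub ?uc ?ud ?va ?vb ?vc ?vd ?uN ?vN.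
rewrite cards2 uv cardsD (setIidPr _) ?cW ?cards2 ?cd //.
by apply/subsetP=> t /set2P[] ->.
Qed.

(** Induction on vertex count, then arc count. In a minimal counterexample, removing a vertex or
    contracting an edge must lose more than 6 arcs. Hence a vertex of degree at most 5, which the
    arc count provides, has degree at least 4 and all its edges lie in three triangles. Degree 4
    gives K5 at once, degree 5 by [degree5_K5]. *)
Theorem minor_closed_arcs_bound V E : symmetric E -> 3 <= #|V| -> D V E ->
  #|arcs V E| + 12 <= 6 * #|V|.
Proof.
have lemax V' E' : #|arcs V' E'| <= #|T| * #|T| by rewrite -card_prod max_card.
have [m] := ubnP (#|V| * (#|T| * #|T|).+1 + #|arcs V E|).
elim: m V E => // m IH V E ltm sE V3 DV.
rewrite leqNgt; apply/negP=> big.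
have V5 : 5 <= #|V|.
  rewrite ltnNge; apply/negP=> V4; have le := card_arcs_le V E.
  have [e|e] : #|V| = 3 \/ #|V| = 4 by lia.
    by rewrite e in le big; lia.
  by rewrite e in le big; lia.
have IHV V' E' : #|V'|.+1 = #|V| -> symmetric E' ->
    D V' E' -> #|arcs V E| <= #|arcs V' E'| + 6 -> False.
  move=> cV' sE' DV' gt; have := IH V' E' _ sE' _ DV'.
  by move: ltm; rewrite -cV' mulSn; have := lemax V' E'; lia.
(* With 6|V| arcs or more, deleting one edge would leave a smaller counterexample. So the average
   degree is below 6. *)
have small : #|arcs V E| < 6 * #|V|.
  rewrite ltnNge; apply/negP=> ge.
  have : 0 < #|arcs V E| by lia.
  case/card_gt0P=> -[u v] uvA.
  set F := delete_edge E u v.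
  have aF : arcs V F = arcs V E :\: [set (u, v); (v, u)].
    apply/setP=> -[s t]; rewrite in_setD !in_arcs /F /delete_edge.
    by rewrite [in RHS]andbC !andbA.
  have cF : #|arcs V E| <= #|arcs V F| + 2.
    rewrite aF cardsD; have := subset_leq_card (subsetIr (arcs V E) [set (u, v); (v, u)]).
    by rewrite cards2; case: (_ != _); lia.
  have ltF : #|arcs V F| < #|arcs V E|.
    apply: proper_card; rewrite properE aF subsetDl /=.
    by apply/subsetPn; exists (u, v) => //; rewrite !inE eqxx.
  have := IH V F _ (delete_edge_sym _ _ sE) V3.
  have DF : D V F by apply: (D_sub _ _ DV) => // s t /andP[].
  by move=> /(_ ltac:(lia) DF); lia.
have [x xV dx] : exists2 x, x \in V & #|nbrs V E x| <= 5.
  apply/exists_inP; rewrite -[X in is_true X]negbK negb_exists_in.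
  apply/negP=> /forall_inP h; move: small; rewrite card_arcs_sum ltnNge.
  rewrite mulnC -sum_nat_const leq_sum // => u uV.
  by have := h _ uV; rewrite -ltnNge.
have cDx : #|V :\ x|.+1 = #|V| by rewrite (cardsD1 x V) xV.
have dx4 : 4 <= #|nbrs V E x|.
  rewrite ltnNge; apply/negP=> dx3.
  apply: (IHV (V :\ x) E) => //.
  - by apply: (D_sub _ _ DV) => //; exact: subsetDl.
  - by apply: leq_trans (card_arcs_remove V x sE) _; lia.
have tri w : w \in nbrs V E x -> 3 <= #|nbrs V E x :&: nbrs V E w|.
  rewrite inE => /and3P[wV wx Exw]; rewrite eq_sym in wx.
  rewrite ltnNge; apply/negP=> le2.
  have := card_arcs_contract sE xV wV wx Exw.
  have cDw : #|V :\ w|.+1 = #|V| by rewrite (cardsD1 w V) wV.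
  move=> le; apply: (IHV _ _ cDw (contract_edge_sym x w sE)); last lia.
  exact: D_contract.
case: (leqP 5 #|nbrs V E x|) => dx5.
  by apply: (degree5_K5 sE xV _ tri DV); lia.
have cN : #|nbrs V E x| = 4 by lia.
have Nfull w : w \in nbrs V E x -> nbrs V E x :&: nbrs V E w = nbrs V E x :\ w.
  move=> wN; apply/eqP; rewrite eqEcard; apply/andP; split.
    by apply/subsetP=> t; rewrite !inE => /andP[-> /and3P[_ -> _]].
  have := tri _ wN; rewrite (cardsD1 w) wN in cN; lia.
apply: (@D_K5 (x |: nbrs V E x) E).
- by rewrite cardsU1 cN inE eqxx andbF.
- move=> u v; rewrite !in_setU1 => /orP[/eqP->|uN] /orP[/eqP->|vN] uv.
  + by rewrite eqxx in uv.
  + by move: vN; rewrite inE => /and3P[].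
  + by rewrite sE; move: uN; rewrite inE => /and3P[].
  + have : v \in nbrs V E x :\ u by rewrite in_setD1 eq_sym uv.
    by rewrite -Nfull // => /setIP[_]; rewrite inE => /and3P[].
- apply: (D_sub _ _ DV) => //; apply/subsetP=> t.
  by rewrite in_setU1 => /orP[/eqP->//|]; rewrite inE => /andP[].
Qed.
End Mader.
End Graphs.

(** * Averaging over the 8-subsets of a finite set *)

Section Averaging.
Variable T : finType.

Lemma card_supersets_le (B : {set T}) m :
  #|[set V : {set T} | (#|V| == m) && (B \subset V)]| <= 'C(#|T| - #|B|, m - #|B|).
Proof.
have -> : #|T| - #|B| = #|~: B| by rewrite -(cardsC B) addKn.
rewrite -cards_draws -(@card_in_imset _ _ (fun V => V :\: B)); last first.
  move=> V V'; rewrite !inE => /andP[_ BV] /andP[_ BV'] e.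
  by rewrite -(setID V B) -(setID V' B) (setIidPr BV) (setIidPr BV') e.
apply/subset_leq_card/subsetP=> _ /imsetP[V /[!inE] /andP[/eqP cV BV] ->].
by rewrite setDE subsetIr -setDE cardsD (setIidPr BV) cV /=.
Qed.

(** Triples (u, v, w) with [w \in W u v] are counted inside 8-subsets: each 8-subset holds at least
    20, each triple lies in at most C(n-3, 5) of them, and at most n(n-1)k triples exist. *)
Lemma average_over_8_subsets (W : T -> T -> {set T}) k :
  (forall u v, u != v -> #|W u v| <= k) ->
  (forall u v, (u \notin W u v) && (v \notin W u v)) -> 8 <= #|T| ->
  (forall V : {set T}, #|V| = 8 ->
     20 <= #|arcs V (fun u v => W u v :&: V != set0)|) ->
  5 * (#|T| - 2) <= 84 * k.
Proof.
move=> Wk Wuv T8 H20; set n := #|T|.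
pose Q := [set q : T * T * T | (q.1.1 != q.1.2) && (q.2 \in W q.1.1 q.1.2)].
pose inV (q : T * T * T) (V : {set T}) := [set q.1.1; q.1.2; q.2] \subset V.
have cQ : #|Q| <= n * n.-1 * k.
  have le : #|arcs [set: T] (fun _ _ => true)| <= n * n.-1.
    by have := card_arcs_le [set: T] (fun _ _ => true); rewrite cardsT.
  apply: leq_trans (leq_mul le (leqnn k)).
  rewrite -sum1_card -sum_nat_const.
  rewrite (eq_bigl (fun q : T * T * T => (q.1 \in arcs [set: T] (fun _ _ => true))
      && (q.2 \in W q.1.1 q.1.2))); last first.
    by move=> [[u v] w]; rewrite !inE /= andbT.
  rewrite -(pair_big_dep (mem (arcs [set: T] (fun _ _ => true)))
     (fun p w => w \in W p.1 p.2) (fun _ _ => 1)) /=.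
  apply: leq_sum => -[u v]; rewrite !inE /= andbT => uv.
  by rewrite sum1_card Wk.
have low (V : {set T}) : #|V| == 8 -> 20 <= #|[set q in Q | inV q V]|.
  move=> /eqP cV; apply: leq_trans (H20 V cV) _.
  apply: leq_trans (leq_imset_card fst _); apply/subset_leq_card/subsetP.
  move=> [u v]; rewrite !inE /= => /and4P[uV vV uv /set0Pn[w /setIP[wW wV]]].
  apply/imsetP; exists (u, v, w) => //; rewrite !inE /= uv wW /inV /=.
  by rewrite !subUset !sub1set uV vV wV.
have up q : q \in Q -> #|[set V : {set T} | (#|V| == 8) && inV q V]| <= 'C(n - 3, 5).
  case: q => [[u v] w]; rewrite inE /= => /andP[uv wW].
  have /andP[uW vW] := Wuv u v.
  have c3 : #|[set u; v; w]| = 3.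
    rewrite setUC cardsU1 cards2 uv !inE negb_or.
    have -> /= : w != u by apply: contraNneq uW => e; rewrite -{1}e.
    by have -> : w != v by apply: contraNneq vW => e; rewrite -{1}e.
  by have := card_supersets_le [set u; v; w] 8; rewrite c3.
have main : 20 * 'C(n, 8) <= n * n.-1 * k * 'C(n - 3, 5).
  apply: leq_trans (leq_mul cQ (leqnn _)).
  rewrite -card_draws mulnC -!sum_nat_const.
  have -> : \sum_(V in [set A : {set T} | #|A| == 8]) 20 = \sum_(V : {set T} | #|V| == 8) 20.
    by apply: eq_bigl => V; rewrite inE.
  apply: (@leq_trans (\sum_(V : {set T} | #|V| == 8) \sum_(q in Q | inV q V) 1)).
    apply: leq_sum => V cV; apply: leq_trans (low V cV) _.
    by rewrite -sum1_card; apply: eq_leq; apply: eq_bigl => q; rewrite inE.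
  rewrite (exchange_big_dep (mem Q)) /=; last by move=> ? ? _ /andP[].
  apply: leq_sum => q qQ; apply: leq_trans (up q qQ).
  rewrite -sum1_card; apply: eq_leq; apply: eq_bigl => V.
  by rewrite inE qQ.
have [m nE] : exists m, n = m.+3 by exists (n - 3); lia.
(* Here 336 = 8 * 7 * 6, and 20/336 = 5/84. *)
have bin8 : m.+3 * m.+2 * m.+1 * 'C(m, 5) = 336 * 'C(m.+3, 8).
  rewrite -!mulnA (mul_bin_diag m.+1 5) (mulnCA m.+2) (mul_bin_diag m.+2 6).
  by rewrite (mulnCA m.+3) (mulnCA m.+3 7) (mul_bin_diag m.+3 7); lia.
have pos8 : 0 < 'C(m.+3, 8) by rewrite bin_gt0 -nE.
have [e2 e3] : m.+3 - 2 = m.+1 /\ m.+3 - 3 = m by lia.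
move: main; rewrite nE e2 e3 /= => main.
have : m.+1 * 20 * 'C(m.+3, 8) <= 336 * k * 'C(m.+3, 8).
  rewrite -mulnA (leq_trans (leq_mul (leqnn m.+1) main)) //.
  by rewrite -[336 * k * _]mulnAC -bin8; nia.
by rewrite leq_pmul2r //; lia.
Qed.
End Averaging.

Require Import Defs.
From HB Require Import structures.
From mathcomp Require Import all_order all_algebra.
From mathcomp Require Import all_classical all_reals all_analysis.
From mathcomp Require Import ring lra.
Import numFieldNormedType.Exports.
Import Order.TTheory GRing.Theory Num.Theory.
Local Open Scope classical_set_scope.
Local Open Scope ring_scope.

(** * Crossing parity of polygonal chains *)

Section Crossings.
Variable R : realType.
Implicit Types (p q x y z a b c d : pt R) (A B : set (pt R)).

Definition lexle p q := (p.1 < q.1) || ((p.1 == q.1) && (p.2 <= q.2)).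

(** Twice the signed area of the triangle pqz, positive when [z] is to the left of the line from [p]
    to [q]. *)
Definition orient p q z : R := cross (vsub q p) (vsub z p).

(* Parity of the crossings of [pq] with the vertical ray above (below) [z]. The
   lexicographic order acts as an infinitesimal shear, so vertical segments and
   equal abscissae need no special treatment. *)
Definition straddles p q z := lexle p z (+) lexle q z.

Definition below p q z := straddles p q z &&
  (if lexle p z then orient p q z < 0 else 0 < orient p q z).

Definition above p q z := straddles p q z &&
  (if lexle p z then 0 < orient p q z else orient p q z < 0).

Lemma lexleNle p q : p != q -> lexle q p = ~~ lexle p q.
Proof.
case: p q => [p1 p2] [q1 q2]; rewrite xpair_eqE /lexle /= negb_and.
by case: (ltrgtP p1 q1) => //= _; case: (ltrgtP p2 q2).
Qed.

Lemma lexle_trans p q z : lexle p q -> lexle q z -> lexle p z.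
Proof.
rewrite /lexle => /orP[h|/andP[/eqP h h']] /orP[k|/andP[/eqP k k']].
- by rewrite (lt_trans h k).
- by rewrite -k h.
- by rewrite h k.
- by rewrite h k eqxx (le_trans h' k') orbT.
Qed.

Lemma segC p q : seg p q = seg q p.
Proof.
by apply/seteqP; split=> z [t t01 ->]; exists (1 - t); [lra|congr pair; ring|lra|congr pair; ring].
Qed.

Lemma segl p q : seg p q p.
Proof. by exists 0; [lra|case: p => p1 p2 /=; congr pair; ring]. Qed.

Lemma segr p q : seg p q q.
Proof. by rewrite segC; exact: segl. Qed.

Lemma orientC p q z : orient q p z = - orient p q z.
Proof. rewrite /orient /cross /vsub /=; ring. Qed.

Lemma straddlesC p q z : straddles q p z = straddles p q z.
Proof. by rewrite /straddles addbC. Qed.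

Lemma belowC p q z : below q p z = below p q z.
Proof.
rewrite /below straddlesC orientC oppr_lt0 oppr_gt0 /straddles.
by case: (lexle p z); case: (lexle q z).
Qed.

Lemma aboveC p q z : above q p z = above p q z.
Proof.
rewrite /above straddlesC orientC oppr_lt0 oppr_gt0 /straddles.
by case: (lexle p z); case: (lexle q z).
Qed.

Lemma lexle_cases p q :
  lexle p q -> p.1 < q.1 \/ p.1 = q.1 /\ p.2 <= q.2.
Proof. by case/orP=> [|/andP[/eqP]]; [left|right]. Qed.

Lemma collinear_seg p q z : lexle p z -> lexle z q -> orient p q z = 0 ->
  seg p q z.
Proof.
case: p q z => [p1 p2] [q1 q2] [z1 z2].
rewrite /orient /cross /vsub => /lexle_cases /= pz /lexle_cases /= zq o0.
have [lt|ge] := ltP p1 q1.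
  have d0 : q1 - p1 != 0 by rewrite subr_eq0 gt_eqF.
  exists ((z1 - p1) / (q1 - p1)).
    rewrite divr_ge0 ?ler_pdivrMr ?subr_gt0 ?mul1r //=; last lra.
      by case: zq => [?|[? ?]]; lra.
    by case: pz => [?|[? ?]]; lra.
  congr pair => /=; first by field.
  have -> : z2 = p2 + (q2 - p2) * (z1 - p1) / (q1 - p1); last by field.
  by apply: (mulfI d0); rewrite mulrDr [_ * (_ / _)]mulrC divfK //; lra.
have [e1 [e2 [l1 l2]]] : z1 = p1 /\ q1 = p1 /\ p2 <= z2 /\ z2 <= q2.
  by case: pz zq => [?|[? ?]] [?|[? ?]]; lra.
have [e|ne] := eqVneq p2 q2.
  by exists 0; [lra|congr pair => /=; lra].
have d0 : q2 - p2 != 0 by rewrite subr_eq0 eq_sym.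
have gt0 : 0 < q2 - p2 by rewrite lt_neqAle eq_sym d0 /=; lra.
exists ((z2 - p2) / (q2 - p2)).
  by rewrite divr_ge0 ?ler_pdivrMr ?mul1r //; lra.
by rewrite e1 e2; congr pair => /=; field.
Qed.

(** A straddled point with [orient] zero would lie on the segment, so exactly one strict side
    holds. *)
Lemma above_addb_below p q z : ~ seg p q z ->
  above p q z (+) below p q z = straddles p q z.
Proof.
move=> nz; rewrite /above /below; case: (boolP (straddles p q z)) => //= st.
have o0 : orient p q z != 0.
  apply/eqP=> o0; apply: nz; move: st; rewrite /straddles.
  case: (boolP (lexle p z)) => [pz|nzp] /=.
    have [->|qz] := eqVneq q z; first by move=> _; exact: segr.
    by rewrite -lexleNle // => zq; exact: collinear_seg.
  move=> qz; rewrite segC; apply: collinear_seg => //.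
    by rewrite lexleNle //; apply: contraNneq nzp => ->; rewrite /lexle eqxx lexx orbT.
  by rewrite orientC o0 oppr0.
by case: (lexle p z); case: ltrgtP o0; rewrite ?eqxx.
Qed.

Lemma lexle_total p q : lexle p q || lexle q p.
Proof.
have [->|/lexleNle ->] := eqVneq p q; last exact: orbN.
by rewrite /lexle eqxx lexx orbT.
Qed.

Lemma cross_ratio_itv (s t : R) : s * t < 0 -> 0 <= s / (s - t) <= 1.
Proof.
move=> st; have [s0|s0|s0] := ltrgtP s 0; last by rewrite s0 mul0r ltxx in st.
  have t0 : 0 < t by rewrite -(nmulr_rlt0 _ s0).
  have st0 : 0 < t - s by lra.
  rewrite -opprB invrN mulrN -mulNr divr_ge0 ?ler_pdivrMr ?mul1r //=; lra.
have t0 : t < 0 by rewrite -(pmulr_rlt0 _ s0).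
have st0 : 0 < s - t by lra.
by rewrite divr_ge0 ?ler_pdivrMr ?mul1r //=; lra.
Qed.

(** Signed areas are affine along a segment, so their ratios locate the common point; the two
    denominators are, up to sign, the cross product of the directions. *)
Lemma proper_crossing p q x y : orient x y p * orient x y q < 0 ->
  orient p q x * orient p q y < 0 -> exists z, seg x y z /\ seg p q z.
Proof.
move=> h1 h2.
have d1 : orient x y p - orient x y q != 0.
  by apply: contraTneq h1 => /eqP; rewrite subr_eq0 => /eqP ->; rewrite -leNgt -expr2 sqr_ge0.
have d2 : orient p q x - orient p q y != 0.
  by apply: contraTneq h2 => /eqP; rewrite subr_eq0 => /eqP ->; rewrite -leNgt -expr2 sqr_ge0.
exists ((1 - orient p q x / (orient p q x - orient p q y)) * x.1
         + orient p q x / (orient p q x - orient p q y) * y.1,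
        (1 - orient p q x / (orient p q x - orient p q y)) * x.2
         + orient p q x / (orient p q x - orient p q y) * y.2).
split; first by exists (orient p q x / (orient p q x - orient p q y)) => //; exact: cross_ratio_itv.
exists (orient x y p / (orient x y p - orient x y q)); first exact: cross_ratio_itv.
have e : orient p q x - orient p q y = - (orient x y p - orient x y q).
  by rewrite /orient /cross /vsub /=; ring.
rewrite e; move: d1; rewrite /orient /cross /vsub /= => d1.
by congr pair; field.
Qed.

Lemma above_lexle p q z : lexle p z -> lexle z q -> q != z ->
  above p q z = (0 < orient p q z).
Proof.
by move=> pz zq qz; rewrite /above /straddles pz lexleNle 1?eq_sym // zq.
Qed.

Lemma below_lexle p q z : lexle p z -> lexle z q -> q != z ->
  below p q z = (orient p q z < 0).
Proof.
by move=> pz zq qz; rewrite /below /straddles pz lexleNle 1?eq_sym // zq.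
Qed.

Lemma lexle_seg p q z : lexle p q -> seg p q z -> lexle p z /\ lexle z q.
Proof.
case: p q => [p1 p2] [q1 q2] /lexle_cases /= pq [t /andP[t0 t1] ->].
case: pq => [lt|[-> le]]; rewrite /lexle /=.
  have [->|tn0] := eqVneq t 0.
    by rewrite subr0 !mul1r !mul0r !addr0 eqxx lexx lt !orbT.
  have tp : 0 < t by rewrite lt_neqAle eq_sym tn0.
  have -> /= : p1 < (1 - t) * p1 + t * q1 by nra.
  have [->|tn1] := eqVneq t 1.
    by rewrite subrr !mul1r !mul0r !add0r eqxx lexx !orbT.
  have tp1 : t < 1 by rewrite lt_neqAle tn1.
  by have -> : (1 - t) * p1 + t * q1 < q1 by nra.
have -> : (1 - t) * q1 + t * q1 = q1 by ring.
by rewrite eqxx ltxx /=; split; nra.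
Qed.

(** [orient x y] is affine along pq, and a zero of it there would lie on xy by [collinear_seg];
    hence its sign is constant. *)
Lemma nested_same_side p q x y : (forall z, seg x y z -> ~ seg p q z) ->
  lexle x p -> lexle p q -> lexle q y -> above x y p = above x y q.
Proof.
move=> dis xp pq qy.
have ney z : seg p q z -> y != z.
  by move=> pqz; apply/eqP=> e; apply: (dis z) => //; rewrite -e; exact: segr.
have nx z : seg p q z -> lexle x z /\ lexle z y.
  by move/(lexle_seg pq) => [pz zq]; split; [exact: lexle_trans xp pz|exact: lexle_trans zq qy].
have on z : seg p q z -> orient x y z != 0.
  move=> pqz; apply/eqP=> o0; apply: (dis z) => //.
  by have [? ?] := nx z pqz; exact: collinear_seg.
have [xq py] : lexle x q /\ lexle p y.
  by split; [exact: (nx q (segr _ _)).1|exact: (nx p (segl _ _)).2].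
rewrite !above_lexle ?ney //; try solve [exact: segl|exact: segr].
have [op oq] := (on p (segl _ _), on q (segr _ _)).
have mid : ~ (orient x y p * orient x y q < 0).
  move=> neg; have d : orient x y p - orient x y q != 0.
    apply: contraTneq neg => /eqP.
    by rewrite subr_eq0 => /eqP ->; rewrite -leNgt -expr2 sqr_ge0.
  set t := orient x y p / (orient x y p - orient x y q).
  have t01 : 0 <= t <= 1 by exact: cross_ratio_itv.
  have := on _ (ex_intro2 _ _ t t01 erefl).
  apply/negP; rewrite negbK; apply/eqP.
  move: d; rewrite /t /orient /cross /vsub /= => d; by field.
move: mid op oq; case: (ltrgtP 0 (orient x y p)); case: (ltrgtP 0 (orient x y q)) => //;
  rewrite ?eqxx //; nra.
Qed.

(** Each pair of coordinate equations is one vector equation in the lexicographically ordered plane.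
    If [s3] were nonnegative, the first would equate a negative with a positive vector; likewise
    [s2] in the second. *)
Lemma lex_dependency_sign (x1 x2 p1 p2 y1 y2 q1 q2 : R) :
  x1 < p1 \/ x1 = p1 /\ x2 < p2 -> p1 < y1 \/ p1 = y1 /\ p2 < y2 ->
  y1 < q1 \/ y1 = q1 /\ y2 < q2 -> forall s1 s2 s3 s4 : R,
  s4 * (x1 - p1) = s3 * (y1 - p1) + s1 * (q1 - p1) ->
  s4 * (x2 - p2) = s3 * (y2 - p2) + s1 * (q2 - p2) ->
  s4 * (x1 - y1) + s2 * (p1 - y1) = s1 * (q1 - y1) ->
  s4 * (x2 - y2) + s2 * (p2 - y2) = s1 * (q2 - y2) ->
  0 < s1 -> 0 < s4 -> s2 < 0 /\ s3 < 0.
Proof.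
move=> xp py yq s1 s2 s3 s4 g1 g2 k1 k2 s1gt s4gt.
have xp1 : x1 <= p1 by case: xp => [?|[? ?]]; lra.
have py1 : p1 <= y1 by case: py => [?|[? ?]]; lra.
have yq1 : y1 <= q1 by case: yq => [?|[? ?]]; lra.
have degen : x1 = q1 -> [/\ x2 < p2, p2 < y2 & y2 < q2].
  move=> e; split.
  - by case: xp => [?|[? ?]]; lra.
  - by case: py => [?|[? ?]]; lra.
  - by case: yq => [?|[? ?]]; lra.
split; rewrite ltNge; apply/negP=> ge0.
  have m1 : 0 <= s4 * (y1 - x1) by rewrite mulr_ge0 //; lra.
  have m2 : 0 <= s2 * (y1 - p1) by rewrite mulr_ge0 //; lra.
  have m3 : 0 <= s1 * (q1 - y1) by rewrite mulr_ge0 //; lra.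
  have z1 : s4 * (y1 - x1) = 0 by lra.
  have z3 : s1 * (q1 - y1) = 0 by lra.
  move/eqP: z1; rewrite mulf_eq0 gt_eqF //= subr_eq0 => /eqP z1.
  move/eqP: z3; rewrite mulf_eq0 gt_eqF //= subr_eq0 => /eqP z3.
  have [d1 d2 d3] := degen ltac:(lra).
  have r1 : 0 < s4 * (y2 - x2) by rewrite mulr_gt0 //; lra.
  have r2 : 0 <= s2 * (y2 - p2) by rewrite mulr_ge0 //; lra.
  have r3 : 0 < s1 * (q2 - y2) by rewrite mulr_gt0 //; lra.
  lra.
have m1 : 0 <= s4 * (p1 - x1) by rewrite mulr_ge0 //; lra.
have m2 : 0 <= s3 * (y1 - p1) by rewrite mulr_ge0 //; lra.
have m3 : 0 <= s1 * (q1 - p1) by rewrite mulr_ge0 //; lra.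
have z1 : s4 * (p1 - x1) = 0 by lra.
have z3 : s1 * (q1 - p1) = 0 by lra.
move/eqP: z1; rewrite mulf_eq0 gt_eqF //= subr_eq0 => /eqP z1.
move/eqP: z3; rewrite mulf_eq0 gt_eqF //= subr_eq0 => /eqP z3.
have [d1 d2 d3] := degen ltac:(lra).
have r1 : 0 < s4 * (p2 - x2) by rewrite mulr_gt0 //; lra.
have r2 : 0 <= s3 * (y2 - p2) by rewrite mulr_ge0 //; lra.
have r3 : 0 < s1 * (q2 - p2) by rewrite mulr_gt0 //; lra.
lra.
Qed.

(** Otherwise [orient x y p] and [orient p q y] have equal signs, the other two orientations have
    the opposite sign, and the segments cross properly. *)
Lemma interleaved_sides p q x y : (forall z, seg x y z -> ~ seg p q z) ->
  lexle x p -> lexle p y -> lexle y q -> below p q y = above x y p.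
Proof.
move=> dis xp py yq.
have [xy pq] := (lexle_trans xp py, lexle_trans py yq).
have nxp : x != p.
  by apply/eqP=> e; apply: (dis p); rewrite -?e; [exact: segl|rewrite e; exact: segl].
have npy : p != y.
  by apply/eqP=> e; apply: (dis p); rewrite ?e; [exact: segr|rewrite -e; exact: segl].
have nyq : y != q.
  by apply/eqP=> e; apply: (dis q); rewrite -?e; [exact: segr|rewrite e; exact: segr].
rewrite below_lexle 1?eq_sym // above_lexle 1?eq_sym //.
have o1 : orient x y p != 0.
  by apply/eqP=> o0; apply: (dis p (collinear_seg xp py o0)); exact: segl.
have o4 : orient p q y != 0.
  by apply/eqP=> o0; apply: (dis y (segr _ _) (collinear_seg py yq o0)).
have strict a b : lexle a b -> a != b -> a.1 < b.1 \/ a.1 = b.1 /\ a.2 < b.2.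
  case: a b => [a1 a2] [b1 b2] /lexle_cases /= [|[-> le]]; first by left.
  by rewrite xpair_eqE eqxx /= => ne; right; rewrite lt_neqAle ne le.
have {xp}xp := strict _ _ xp nxp; have {py}py := strict _ _ py npy.
have {yq}yq := strict _ _ yq nyq.
have noX : ~ (orient x y p * orient x y q < 0 /\ orient p q x * orient p q y < 0).
  by case=> h1 h2; have [z [z1 z2]] := proper_crossing h1 h2; exact: dis z1 z2.
(* The four orientations are the coefficients of the affine dependency between
   [x], [y], [p] and [q]. *)
have e1 : orient p q y * (x.1 - p.1) =
    orient p q x * (y.1 - p.1) + orient x y p * (q.1 - p.1).
  by rewrite /orient /cross /vsub /=; ring.
have e2 : orient p q y * (x.2 - p.2) =
    orient p q x * (y.2 - p.2) + orient x y p * (q.2 - p.2).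
  by rewrite /orient /cross /vsub /=; ring.
have f1 : orient p q y * (x.1 - y.1) + orient x y q * (p.1 - y.1) =
    orient x y p * (q.1 - y.1).
  by rewrite /orient /cross /vsub /=; ring.
have f2 : orient p q y * (x.2 - y.2) + orient x y q * (p.2 - y.2) =
    orient x y p * (q.2 - y.2).
  by rewrite /orient /cross /vsub /=; ring.
move: noX o1 o4 e1 e2 f1 f2.
move: (orient x y p) (orient x y q) (orient p q x) (orient p q y) => o1 o2 o3 o4.
case: x y p q xp py yq {dis xy pq nxp npy nyq} => [x1 x2] [y1 y2] [p1 p2] [q1 q2] /=.
move=> xp py yq noX n1 n4 e1 e2 f1 f2.
have key := lex_dependency_sign xp py yq.
have [l1|g1|e0] := ltrgtP o1 0; last by rewrite e0 eqxx in n1.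
  have [l4|g4|e0] := ltrgtP o4 0; last by rewrite e0 eqxx in n4.
    exfalso; apply: noX.
    have [||||||h2 h3] := key (- o1) (- o2) (- o3) (- o4); try lra.
    by split; nra.
  by [].
have [l4|g4|e0] := ltrgtP o4 0; last by rewrite e0 eqxx in n4.
  by [].
exfalso; apply: noX; have [||||||h2 h3] := key o1 o2 o3 o4; try lra.
by split; nra.
Qed.

(** Extend xy by upward rays at both ends and pq by downward ones. The two curves cross an even
    number of times, and only the four ray-segment crossings can occur. The proof distinguishes
    separated, nested and interleaved lexicographic ranges. *)
Lemma disjoint_seg_parity p q x y : (forall z, seg x y z -> ~ seg p q z) ->
  below p q x (+) below p q y (+) above x y p (+) above x y q = false.
Proof.
wlog xy : x y / lexle x y => [hw|].
  have /orP[] := lexle_total x y => h dis; first exact: hw.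
  rewrite -(hw y x h) ?[seg y x]segC // [above x y p]aboveC [above x y q]aboveC.
  by rewrite [below p q x (+) _]addbC.
wlog pq : p q / lexle p q => [hw|].
  have /orP[] := lexle_total p q => h dis; first exact: hw.
  rewrite -(hw q p h) ?[seg q p]segC // [below p q x]belowC [below p q y]belowC.
  by rewrite -!addbA [above x y p (+) _]addbC.
move=> dis.
have dis' z : seg p q z -> ~ seg x y z by move=> h /dis.
have nst a b z : lexle a z = lexle b z -> below a b z = false /\ above a b z = false.
  by rewrite /below /above /straddles => ->; rewrite addbb.
have ltl a b z : lexle a b -> ~~ lexle a z -> ~~ lexle b z.
  by move=> ab; apply: contra; exact: lexle_trans ab.
have ne s t : seg x y s -> seg p q t -> s != t.
  by move=> h h'; apply/eqP=> e; apply: (dis s) => //; rewrite e.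
have [xp yp] := (ne x p (segl _ _) (segl _ _), ne y p (segr _ _) (segl _ _)).
have [xq yq] := (ne x q (segl _ _) (segr _ _), ne y q (segr _ _) (segr _ _)).
have [lxp|npx] := boolP (lexle x p).
  have npx : ~~ lexle p x by rewrite lexleNle // lxp.
  have [-> _] : below p q x = false /\ above p q x = false.
    by apply: nst; rewrite (negPf npx) (negPf (ltl _ _ _ pq npx)).
  have [lyp|nyp] := boolP (lexle y p).
    have npy : ~~ lexle p y by rewrite lexleNle // lyp.
    have [-> _] := nst p q y ltac:(by rewrite (negPf npy) (negPf (ltl _ _ _ pq npy))).
    have [_ ->] := nst x y p ltac:(by rewrite lxp lyp).
    by have [_ ->] := nst x y q ltac:(by rewrite (lexle_trans lxp pq) (lexle_trans lyp pq)).
  have lpy : lexle p y by rewrite lexleNle.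
  have [lyq|nyq] := boolP (lexle y q).
    have [_ ->] := nst x y q ltac:(by rewrite (lexle_trans xy lyq) lyq).
    by rewrite (interleaved_sides dis lxp lpy lyq) /= addbF addbb.
  have lqy : lexle q y by rewrite lexleNle.
  have [-> _] := nst p q y ltac:(by rewrite lpy lqy).
  by rewrite (nested_same_side dis lxp pq lqy) /= addbb.
have lpx : lexle p x by rewrite lexleNle.
have npy : lexle p y := lexle_trans lpx xy.
have nyp : ~~ lexle y p by rewrite lexleNle 1?eq_sym // npy.
have [_ ->] := nst x y p ltac:(by rewrite (negPf npx) (negPf nyp)).
have [lqx|nqx] := boolP (lexle q x).
  have nxq : ~~ lexle x q by rewrite lexleNle 1?eq_sym // lqx.
  have [-> _] := nst p q x ltac:(by rewrite lpx lqx).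
  have [-> _] := nst p q y ltac:(by rewrite npy (lexle_trans lqx xy)).
  by have [_ ->] := nst x y q ltac:(by rewrite (negPf nxq) (negPf (ltl _ _ _ xy nxq))).
have lxq : lexle x q by rewrite lexleNle // eq_sym.
(* With [p] first, the case lemmas apply with the segments exchanged, so [below] and [above] must be
   traded for each other. *)
have flip a b z : ~ seg a b z -> straddles a b z -> below a b z = ~~ above a b z.
  by move=> /above_addb_below <-; case: above; case: below.
have qxP : below p q x = ~~ above p q x.
  apply: flip; first by apply: dis; exact: segl.
  by rewrite /straddles lpx (negPf nqx).
rewrite qxP addbF.
have [lqy|nqy] := boolP (lexle q y).
  have [-> _] := nst p q y ltac:(by rewrite npy lqy).
  rewrite -(interleaved_sides dis' lpx lxq lqy) flip.
  - by case: above.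
  - by apply: dis'; exact: segr.
  - have nyq : ~~ lexle y q by rewrite lexleNle 1?eq_sym // lqy.
    by rewrite /straddles lxq (negPf nyq).
have lyq : lexle y q by rewrite lexleNle // eq_sym.
have [_ ->] := nst x y q ltac:(by rewrite lxq lyq).
rewrite (nested_same_side dis' lpx xy lyq) [below p q y]flip ?addbF ?addbb //.
- by apply: dis; exact: segr.
- by rewrite /straddles npy (negPf nqy).
Qed.

Fixpoint below_chain a (t : seq (pt R)) z :=
  if t is b :: t' then below a b z (+) below_chain b t' z else false.

Fixpoint above_chain a (t : seq (pt R)) z :=
  if t is b :: t' then above a b z (+) above_chain b t' z else false.

Lemma above_addb_below_chain A a t z : chain_in A a t -> ~ A z ->
  above_chain a t z (+) below_chain a t z = lexle a z (+) lexle (last a t) z.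
Proof.
elim: t a => [|b t IH] a /=; first by rewrite addbb.
move=> [sA chA] nz; rewrite addbACA IH // above_addb_below; last by move/sA.
by rewrite /straddles; case: (lexle a z); case: (lexle b z); case: lexle.
Qed.

Lemma disjoint_seg_chain_parity A B x y c s : seg x y `<=` A ->
  chain_in B c s -> A `&` B = set0 ->
  below_chain c s x (+) below_chain c s y
    (+) above x y c (+) above x y (last c s) = false.
Proof.
move=> xyA + AB; elim: s c => [|b s IH] c /=; first by rewrite addbb.
move=> [sB chB]; rewrite -[RHS](IH b chB) -[RHS]addFb.
rewrite -[X in _ = X (+) _](@disjoint_seg_parity c b x y); last first.
  by move=> z /xyA Az /sB Bz; have : (A `&` B) z by []; rewrite AB.
move: (below c b x) (below c b y) (below_chain b s x) (below_chain b s y).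
by move: (above x y c) (above x y b) (above x y (last b s)) => [] [] [] [] [] [] [].
Qed.

Lemma disjoint_chain_parity A B a t c s : chain_in A a t ->
  chain_in B c s -> A `&` B = set0 ->
  below_chain c s a (+) below_chain c s (last a t)
    (+) above_chain a t c (+) above_chain a t (last c s) = false.
Proof.
move=> + chB AB; elim: t a => [|b t IH] a /=; first by rewrite addbb.
move=> [sA chA]; rewrite -[RHS](IH b chA) -[RHS]addFb.
rewrite -[X in _ = X (+) _](disjoint_seg_chain_parity sA chB AB).
move: (above a b c) (above a b (last c s)) (above_chain b t c)
  (above_chain b t (last c s)) (below_chain c s a) (below_chain c s b)
  (below_chain c s (last b t)).
by move=> [] [] [] [] [] [] [].
Qed.
End Crossings.

(** * Polygonal connectedness and nonplanarity of K5 *)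

Section Drawings.
Variable R : realType.
Implicit Types (a b c z : pt R) (A B : set (pt R)) (t s : seq (pt R)).

(** The [rcons] forces at least one segment, so both ends belong to [A] even when they coincide. *)
Definition polyconn A a b := exists t, chain_in A a (rcons t b).

Lemma chain_in_cat A a t s :
  chain_in A a (t ++ s) <-> chain_in A a t /\ chain_in A (last a t) s.
Proof.
elim: t a => [|b t IH] a /=; first by split=> [|[]].
by rewrite IH; split=> [[? []]|[[]]].
Qed.

Lemma chain_in_sub A B a t : A `<=` B -> chain_in A a t -> chain_in B a t.
Proof.
move=> AB; elim: t a => //= b t IH a [sA chA].
by split; [exact: subset_trans AB|exact: IH].
Qed.

Lemma chain_in_rev A a t b : chain_in A a (rcons t b) ->
  chain_in A b (rcons (rev t) a).
Proof.
elim: t a => [|c t IH] a /=; first by rewrite segC.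
move=> [sA /IH chA]; rewrite rev_cons -cats1; apply/chain_in_cat.
by split=> //=; rewrite last_rcons segC.
Qed.

Lemma polyconn_sub A B a b : A `<=` B -> polyconn A a b -> polyconn B a b.
Proof. by move=> AB [t /(chain_in_sub AB) h]; exists t. Qed.

Lemma polyconn_sym A a b : polyconn A a b -> polyconn A b a.
Proof. by move=> [t /chain_in_rev h]; exists (rev t). Qed.

Lemma polyconn_trans A a b c : polyconn A a b -> polyconn A b c -> polyconn A a c.
Proof.
move=> [t ht] [s hs]; exists (rcons t b ++ s); rewrite rcons_cat.
by apply/chain_in_cat; rewrite last_rcons.
Qed.

Lemma polyconn_mem A a b : polyconn A a b -> A a.
Proof. by case=> -[|c t] /= [sA _]; apply: sA; exact: segl. Qed.

(* In the sum of the fifteen relations [disjoint_chain_parity] of independent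
   pairs of edges every crossing term occurs twice, whereas the order terms add
   up to the number of interleaved pairs, one for each of the five 4-subsets. *)
Lemma K5_nonplanar (p : nat -> pt R) (A : nat -> nat -> set (pt R)) :
  {in gtn 5 &, injective p} ->
  {in gtn 5 &, forall i j, i != j -> polyconn (A i j) (p i) (p j)} ->
  (forall i j k l, all (gtn 5) [:: i; j; k; l] -> uniq [:: i; j; k; l] ->
     A i j `&` A k l = set0) -> False.
Proof.
move=> injp conn dis.
have /choice[f fP] : forall ij : nat * nat, exists t, (ij.1 < 5)%N ->
    (ij.2 < 5)%N -> ij.1 != ij.2 ->
    chain_in (A ij.1 ij.2) (p ij.1) (rcons t (p ij.2)).
  move=> [i j] /=; have [i5|?] := boolP (i < 5)%N; last by exists [::].
  have [j5|?] := boolP (j < 5)%N; last by exists [::].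
  have [?|ij] := eqVneq i j; first by exists [::].
  by have [t ht] := conn _ _ i5 j5 ij; exists t.
pose H k i j := below_chain (p i) (rcons (f (i, j)) (p j)) (p k).
pose L i j := lexle (p i) (p j).
have LN i j : (i < 5)%N -> (j < 5)%N -> i != j -> (L i j + L j i = 1)%N.
  move=> i5 j5 ij; rewrite /L (@lexleNle _ (p i) (p j)); first by case: lexle.
  by apply: contraNneq ij => /injp ->.
have rel i j k l : all (gtn 5) [:: i; j; k; l] -> uniq [:: i; j; k; l] ->
  exists m, (H i k l + H j k l + H k i j + H l i j
              + L i k + L j k + L i l + L j l = m.*2)%N.
  move=> h5 u; have AB := dis i j k l h5 u.
  move: h5 u => /and5P[i5 j5 k5 l5 _] /= /and4P[].
  rewrite !inE !negb_or => /and3P[ij ik il] /andP[jk jl] kl _.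
  have cij := fP (i, j) i5 j5 ij; have ckl := fP (k, l) k5 l5 kl.
  have := disjoint_chain_parity cij ckl AB; rewrite !last_rcons /=.
  have nA z : A k l z -> ~ A i j z.
    by move=> kz iz; have : (A i j `&` A k l) z by []; rewrite AB.
  have Ak : A k l (p k) by exact: polyconn_mem (conn _ _ k5 l5 kl).
  have Al : A k l (p l).
    by apply: polyconn_mem (polyconn_sym (conn _ _ k5 l5 kl)).
  have := above_addb_below_chain cij (nA _ Ak).
  have := above_addb_below_chain cij (nA _ Al).
  rewrite !last_rcons /= -!/(H _ _ _) -!/(L _ _) => e1 e2 e3.
  set n := (_ + _)%N; exists n./2; rewrite -[LHS]odd_double_half.
  suff -> : odd n = false by [].
  rewrite /n !oddD !oddb -[RHS]e3.
  (* Trading [above] for [below] and order terms lets every relation speak of the same numbers [H],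
     which can then cancel. *)
  have {}e1 : above_chain (p i) (rcons (f (i, j)) (p j)) (p l) = H l i j (+) (L i l (+) L j l).
    by rewrite -e1 addbC addbK.
  have {}e2 : above_chain (p i) (rcons (f (i, j)) (p j)) (p k) = H k i j (+) (L i k (+) L j k).
    by rewrite -e2 addbC addbK.
  rewrite -/(H i k l) -/(H j k l) e1 e2.
  move: (H i k l) (H j k l) (H k i j) (H l i j) (L i k) (L j k) (L i l) (L j l).
  by move=> [] [] [] [] [] [] [] [].
(* Over the naturals, the fifteen parity relations and the ten order relations form an unsolvable
   linear system, refuted by [lia]. *)
pose Hn k i j : nat := H k i j; pose Ln i j : nat := L i j.
have {}rel i j k l := rel i j k l : _ -> _ -> exists m,
  (Hn i k l + Hn j k l + Hn k i j + Hn l i j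
     + Ln i k + Ln j k + Ln i l + Ln j l = m.*2)%N.
have {}LN i j := LN i j : _ -> _ -> _ -> (Ln i j + Ln j i = 1)%N.
move: Hn Ln rel LN; clear=> H L rel LN.
have [m1 e1] := rel 0 1 2 3 isT isT.
have [m2 e2] := rel 0 2 1 3 isT isT.
have [m3 e3] := rel 0 3 1 2 isT isT.
have [m4 e4] := rel 0 1 2 4 isT isT.
have [m5 e5] := rel 0 2 1 4 isT isT.
have [m6 e6] := rel 0 4 1 2 isT isT.
have [m7 e7] := rel 0 1 3 4 isT isT.
have [m8 e8] := rel 0 3 1 4 isT isT.
have [m9 e9] := rel 0 4 1 3 isT isT.
have [m10 e10] := rel 0 2 3 4 isT isT.
have [m11 e11] := rel 0 3 2 4 isT isT.
have [m12 e12] := rel 0 4 2 3 isT isT.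
have [m13 e13] := rel 1 2 3 4 isT isT.
have [m14 e14] := rel 1 3 2 4 isT isT.
have [m15 e15] := rel 1 4 2 3 isT isT.
have n01 := LN 0 1 isT isT isT; have n02 := LN 0 2 isT isT isT.
have n03 := LN 0 3 isT isT isT; have n04 := LN 0 4 isT isT isT.
have n12 := LN 1 2 isT isT isT; have n13 := LN 1 3 isT isT isT.
have n14 := LN 1 4 isT isT isT; have n23 := LN 2 3 isT isT isT.
have n24 := LN 2 4 isT isT isT; have n34 := LN 3 4 isT isT isT.
clear rel LN; lia.
Qed.
End Drawings.

(** * Graphs drawn with disjoint independent edges *)

Section DrawableGraphs.
Variables (R : realType) (T : finType) (pos : T -> pt R).
Implicit Types (V : {set T}) (E : rel T).

(* Adjacent edges are allowed to meet; only independent ones must be disjoint. *)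
Definition drawable V E := exists A : T -> T -> set (pt R),
  {in V &, forall u v, u != v -> E u v -> polyconn (A u v) (pos u) (pos v)} /\
  (forall a b c d, {subset [:: a; b; c; d] <= V} -> uniq [:: a; b; c; d] ->
     E a b -> E c d -> A a b `&` A c d = set0).

Lemma drawable_sub V V' E E' : V' \subset V -> (forall u v, E' u v -> E u v) ->
  drawable V E -> drawable V' E'.
Proof.
move=> /fintype.subsetP VV EE [A [conn dis]]; exists A; split.
  by move=> u v /VV uV /VV vV uv /EE; exact: conn.
by move=> a b c d sV u /EE ? /EE ?; apply: dis => // x /sV /VV.
Qed.

(** A new edge from [x] to [v] runs along xy and then yv. Rerouted edges all end at [x], so no two
    of them are independent. *)
Lemma drawable_contract V E x y : symmetric E ->
  x \in V -> y \in V -> x != y -> E x y ->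
  drawable V E -> drawable (V :\ y) (contract_edge E x y).
Proof.
move=> sE xV yV xy Exy [A [conn dis]].
pose B u v := if E u v then A u v else
  if (u == x) && E y v then A x y `|` A y v else A u y `|` A y x.
exists B; split.
  move=> u v; rewrite !finset.in_setD1 => /andP[uy uV] /andP[vy vV] uv.
  rewrite /contract_edge uv /B /=; case: ifP => [Euv _|nE /=]; first exact: conn.
  case: ifP => [/andP[/eqP ux Eyv] _|_ /=].
    rewrite ux; apply: (@polyconn_trans _ _ _ (pos y)).
      by apply: polyconn_sub (conn _ _ xV yV xy Exy) => z; left.
    by apply: polyconn_sub (conn _ _ yV vV _ Eyv) => [z|]; [right|rewrite eq_sym].
  case/andP=> /eqP vx Euy; rewrite vx; apply: (@polyconn_trans _ _ _ (pos y)).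
    by apply: polyconn_sub (conn _ _ uV yV uy Euy) => z; left.
  apply: polyconn_sub (conn _ _ yV xV _ _) => [z||]; [by right| |by rewrite sE].
  by rewrite eq_sym.
(* Each point of a new edge lies on an old edge [e f], which involves [y] only if [x] is an end of
   the new edge. Old edges under independent new ones are thus independent. *)
have BA u v z : u != y -> v != y -> contract_edge E x y u v -> B u v z ->
    exists e f, [/\ E e f, e != f, A e f z, {subset [:: e; f] <= [:: u; v; y]} &
                    y \in [:: e; f] -> x \in [:: u; v]].
  rewrite /contract_edge /B /= => uy vy /andP[uv]; case: ifP => [Euv _ Az|_ /=].
    exists u, v; split=> //; first by move=> w; rewrite !inE => /orP[] /eqP ->; rewrite eqxx ?orbT.
    by rewrite !inE ![y == _]eq_sym (negPf uy) (negPf vy).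
  rewrite eq_sym in vy.
  case: ifP => [/andP[/eqP -> Eyv] _|_ /= /andP[/eqP -> Euy]] [] Az.
  - exists x, y; split=> //; last by move=> _; rewrite !inE eqxx.
    by move=> w; rewrite !inE => /orP[] /eqP ->; rewrite eqxx ?orbT.
  - exists y, v; split=> //; last by move=> _; rewrite !inE eqxx.
    by move=> w; rewrite !inE => /orP[] /eqP ->; rewrite eqxx ?orbT.
  - exists u, y; split=> //; last by move=> _; rewrite !inE eqxx orbT.
    by move=> w; rewrite !inE => /orP[] /eqP ->; rewrite eqxx ?orbT.
  - exists y, x; split=> //; [by rewrite sE|by rewrite eq_sym| |].
      by move=> w; rewrite !inE => /orP[] /eqP ->; rewrite eqxx ?orbT.
    by move=> _; rewrite !inE eqxx orbT.
move=> a b c d sV uabcd Eab Ecd; apply/seteqP; split=> // z [] Bab Bcd.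
have V' w : w \in [:: a; b; c; d] -> (w != y) /\ (w \in V).
  by move/sV; rewrite finset.in_setD1 => /andP[].
have [[ay aV] [by' bV]] : ((a != y) /\ (a \in V)) /\ ((b != y) /\ (b \in V)).
  by split; apply: V'; rewrite !inE eqxx ?orbT.
have [[cy cV] [dy dV]] : ((c != y) /\ (c \in V)) /\ ((d != y) /\ (d \in V)).
  by split; apply: V'; rewrite !inE eqxx ?orbT.
have [e [f [Eef ef Aef sef yef]]] := BA _ _ _ ay by' Eab Bab.
have [g [h [Egh gh Agh sgh ygh]]] := BA _ _ _ cy dy Ecd Bcd.
have dabcd w : w \in [:: a; b] -> w \in [:: c; d] -> False.
  move=> w1 w2; have : ~~ has (mem [:: a; b]) [:: c; d].
    by move: uabcd; rewrite -[[:: a; b; c; d]]/([:: a; b] ++ [:: c; d]) cat_uniq => /and3P[].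
  by move/hasPn=> /(_ w w2); rewrite /= w1.
have efgh w : w \in [:: e; f] -> w \in [:: g; h] -> False.
  move=> w1 w2; have [wy|wy] := eqVneq w y.
    by rewrite wy in w1 w2; exact: dabcd (yef w1) (ygh w2).
  have := sef _ w1; have := sgh _ w2; rewrite !inE (negPf wy) !orbF => h1 h2.
  by apply: (dabcd w); rewrite !inE.
have : (A e f `&` A g h) z by split.
rewrite (dis e f g h) //.
  have sab w u v : u \in V -> v \in V -> w \in [:: u; v; y] -> w \in V.
    by move=> uV vV; rewrite !inE => /or3P[] /eqP ->.
  move=> w; rewrite -[[:: e; f; g; h]]/([:: e; f] ++ [:: g; h]) mem_cat => /orP[].
    by move/sef; exact: sab.
  by move/sgh; exact: sab.
rewrite -[[:: e; f; g; h]]/([:: e; f] ++ [:: g; h]) cat_uniq /= !inE ef gh !andbT /=.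
apply/norP; split; [|apply/norP; split=> //]; apply/negP=> wef.
  by apply: (efgh g); rewrite !inE ?eqxx.
by apply: (efgh h); rewrite !inE ?eqxx ?orbT.
Qed.

Hypothesis pos_inj : injective pos.

Lemma K5_not_drawable V E : #|V| = 5%N ->
  {in V &, forall u v, u != v -> E u v} -> ~ drawable V E.
Proof.
move=> cV KV [A [conn dis]].
have [x0 x0V] : exists x, x \in V by apply/card_gt0P; rewrite cV.
pose v := nth x0 (enum V).
have sz : size (enum V) = 5%N by rewrite -cardE.
have vV i : (i < 5)%N -> v i \in V by move=> i5; rewrite -mem_enum mem_nth ?sz.
have v_eq i j : (i < 5)%N -> (j < 5)%N -> (v i == v j) = (i == j).
  by move=> i5 j5; rewrite nth_uniq ?sz ?enum_uniq.
apply: (@K5_nonplanar _ (pos \o v) (fun i j => A (v i) (v j))).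
- by move=> i j i5 j5 /pos_inj/eqP; rewrite v_eq // => /eqP.
- by move=> i j i5 j5 ij /=; apply: conn; rewrite ?vV ?KV ?v_eq ?vV.
move=> i j k l /and5P[i5 j5 k5 l5 _] u; apply: dis.
- by move=> w; rewrite !inE => /or4P[] /eqP ->; exact: vV.
- move: u; rewrite /= !inE !v_eq //.
- by move: u; rewrite /= !inE => /and3P[/norP[ij _] _ _]; apply: KV; rewrite ?vV ?v_eq.
- by move: u; rewrite /= !inE => /and4P[_ _ kl _]; apply: KV; rewrite ?vV ?v_eq.
Qed.

Lemma drawable_arcs_bound V E : symmetric E -> (3 <= #|V|)%N ->
  drawable V E -> (#|arcs V E| + 12 <= 6 * #|V|)%N.
Proof.
apply: minor_closed_arcs_bound.
- exact: drawable_sub.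
- exact: drawable_contract.
- exact: K5_not_drawable.
Qed.
End DrawableGraphs.

(** * Geodesic distance *)

Section GeodesicDistance.
Variables (R : realType) (P : set (pt R)).
Implicit Types (a b c z : pt R) (t s : seq (pt R)).

Lemma edist_ge0 a b : 0 <= Defs.edist a b.
Proof. exact: sqrtr_ge0. Qed.

Lemma edist_seg a b z : seg a b z -> Defs.edist a z + Defs.edist z b = Defs.edist a b.
Proof.
have scale (t : R) (X : R) : 0 <= t -> Num.sqrt (t ^+ 2 * X) = t * Num.sqrt X.
  by move=> t0; rewrite sqrtrM ?sqr_ge0 // sqrtr_sqr ger0_norm.
case: a b => [a1 a2] [b1 b2] [t /andP[t0 t1] ->]; rewrite /Defs.edist /=.
set X := (a1 - b1) ^+ 2 + (a2 - b2) ^+ 2.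
have -> : (a1 - ((1 - t) * a1 + t * b1)) ^+ 2
    + (a2 - ((1 - t) * a2 + t * b2)) ^+ 2 = t ^+ 2 * X by rewrite /X; ring.
have -> : ((1 - t) * a1 + t * b1 - b1) ^+ 2
    + ((1 - t) * a2 + t * b2 - b2) ^+ 2 = (1 - t) ^+ 2 * X by rewrite /X; ring.
by rewrite !scale ?subr_ge0 //; ring.
Qed.

Lemma seg_subl a b z : seg a b z -> seg a z `<=` seg a b.
Proof.
move=> [t /andP[t0 t1] ->] w [s /andP[s0 s1] ->] /=; exists (s * t); last by congr pair; ring.
by rewrite mulr_ge0 ?mulr_ile1.
Qed.

Lemma seg_subr a b z : seg a b z -> seg z b `<=` seg a b.
Proof.
by move=> h; rewrite (segC z) (segC a); apply: seg_subl; rewrite segC.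
Qed.

Lemma chain_len_ge0 a t : 0 <= chain_len a t.
Proof. by elim: t a => //= b t IH a; rewrite addr_ge0 ?edist_ge0. Qed.

Lemma chain_len_cat a t s :
  chain_len a (t ++ s) = chain_len a t + chain_len (last a t) s.
Proof. by elim: t a => [|b t IH] a /=; rewrite ?add0r // IH addrA. Qed.

Lemma gdist_le_chain a t : P a -> chain_in P a t ->
  gdist P a (last a t) <= chain_len a t.
Proof.
move=> Pa ch; apply: ge_inf; first by exists 0 => _ [s [_ ->]]; exact: chain_len_ge0.
case/lastP: t ch => [_|t b ch] /=; last by exists t; rewrite last_rcons.
(* The empty chain does not compete in [gdist P a a]; the degenerate segment from [a] to [a] does,
   with length 0. *)
exists [::]; split=> /=.
  by split=> // z [s _ ->]; case: a Pa => a1 a2 /=;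
     rewrite -!mulrDl subrK !mul1r.
by rewrite addr0 /Defs.edist !subrr expr0n /= addr0 sqrtr0.
Qed.

Lemma gdist_approx a b e : polyconn P a b -> 0 < e ->
  exists2 t, chain_in P a (rcons t b) & chain_len a (rcons t b) < gdist P a b + e.
Proof.
move=> [t0 ch0] e0.
have [|_ [t [ch ->]] lt] := @inf_adherent _ [set l : R | exists t : seq (pt R),
    chain_in P a (rcons t b) /\ l = chain_len a (rcons t b)] e e0.
  split; first by exists (chain_len a (rcons t0 b)), t0.
  by exists 0 => _ [s [_ ->]]; exact: chain_len_ge0.
by exists t.
Qed.

Lemma gdist_triangle a b c : polyconn P a b -> polyconn P b c ->
  gdist P a c <= gdist P a b + gdist P b c.
Proof.
move=> ab bc; apply/ler_addgt0Pr => e e0.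
have e2 : 0 < e / 2 by rewrite divr_gt0.
have [t ht lt] := gdist_approx ab e2; have [s hs ls] := gdist_approx bc e2.
have Pa := polyconn_mem ab.
have ch : chain_in P a (rcons t b ++ rcons s c).
  by apply/chain_in_cat; rewrite last_rcons.
have := gdist_le_chain Pa ch; rewrite last_cat !last_rcons chain_len_cat last_rcons.
by move=> h; lra.
Qed.

Lemma chain_in_split a t : chain_in P a t ->
  chain_in [set z | exists t1 t2, [/\ chain_in P a t1, chain_in P z t2,
      last a t1 = z, last z t2 = last a t &
      chain_len a t1 + chain_len z t2 = chain_len a t]] a t.
Proof.
elim: t a => //= b t IH a [sP ch]; split.
  move=> z abz; exists [:: z], (b :: t) => /=; split=> //.
  - by split=> //; exact: subset_trans (seg_subl abz) sP.
  - by split=> //; exact: subset_trans (seg_subr abz) sP.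
  - by rewrite addr0 addrA edist_seg.
apply: chain_in_sub (IH b ch) => z [t1 [t2 [c1 c2 l1 l2 e]]].
by exists (b :: t1), t2; split=> //=; rewrite -addrA e.
Qed.

(** The filled geodesic ellipse with foci [a] and [b], standing in for a shortest path: it contains
    every chain of length at most [l] joining the foci inside [P]. *)
Definition ellipse a b (l : R) : set (pt R) :=
  [set z | P z /\ gdist P a z + gdist P z b <= l].

Lemma polyconn_ellipse a b l : polyconn P a b -> gdist P a b < l ->
  polyconn (ellipse a b l) a b.
Proof.
move=> ab abl; have Pa := polyconn_mem ab.
have [|t ch lt] := @gdist_approx a b (l - gdist P a b) ab; first by rewrite subr_gt0.
exists t; apply: chain_in_sub (chain_in_split ch) => z [t1 [t2 [c1 c2 l1]]].
rewrite last_rcons => l2 e.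
have Pz : P z.
  rewrite -l1; elim: t1 a c1 Pa {ab abl ch lt l1 e} => //= w t1 IH a [sP c1] Pa.
  by apply: IH c1 _; apply: sP; exact: segr.
split=> //; have := gdist_le_chain Pa c1; have := gdist_le_chain Pz c2.
by rewrite l1 l2; lra.
Qed.
End GeodesicDistance.

(** * Polygonal connectedness of the region *)

Section RegionConnected.
Variable R : realType.
Implicit Types (vs : seq (pt R)) (p q x y : pt R).

Definition seg_map p q (t : R) : pt R :=
  ((1 - t) * p.1 + t * q.1, (1 - t) * p.2 + t * q.2).

Lemma seg_image p q : seg p q = seg_map p q @` `[0, 1].
Proof.
by apply/seteqP; split=> z [t t01 e]; exists t => //; move: t01; rewrite /= in_itv.
Qed.

Lemma seg_map_continuous p q : continuous (seg_map p q).
Proof.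
have aff (a b : R) : continuous (fun t : R => (1 - t) * a + t * b).
  move=> t; apply: cvgD; apply: cvgM; do ?exact: cvg_cst; last exact: cvg_id.
  by apply: cvgB; [exact: cvg_cst|exact: cvg_id].
by move=> t; exact: (cvg_pair (aff p.1 q.1 t) (aff p.2 q.2 t)).
Qed.

Lemma seg_closed p q : closed (seg p q).
Proof.
apply: compact_closed; first exact: norm_hausdorff.
rewrite seg_image; apply: continuous_compact; last exact: segment_compact.
by apply: continuous_subspaceT; exact: seg_map_continuous.
Qed.

Lemma seg_connected p q : connected (seg p q).
Proof.
rewrite seg_image; apply: connected_continuous_connected; first exact: segment_connected.
by apply: continuous_subspaceT; exact: seg_map_continuous.
Qed.

Lemma pboundary_closed vs : closed (pboundary vs).
Proof. by apply: closed_bigcup => [|i _]; [exact: finite_II|exact: seg_closed]. Qed.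

(* The boundary is met by shooting a ray from an interior point: until its
   first hit the ray stays in the bounded component. *)
Lemma region_polyconn_boundary vs x : region vs x ->
  exists2 y, pboundary vs y & polyconn (region vs) x y.
Proof.
move=> rx; have [bx|nbx] := pselect (pboundary vs x).
  exists x => //; exists [::]; split=> // z [t _ ->].
  by case: x rx {bx} => x1 x2 rx /=; rewrite -!mulrDl subrK !mul1r.
case: rx => // -[_ bd].
pose ray (t : R) : pt R := (x.1 + t, x.2).
have ray_seg (t s : R) : 0 <= t <= s -> seg x (ray s) (ray t).
  move=> /andP[t0 ts]; have [s0|s0] := eqVneq s 0.
    have -> : t = s by lra.
    exact: segr.
  exists (t / s); last by congr pair => /=; field.
  have sp : 0 < s by rewrite lt_neqAle eq_sym s0; lra.
  by rewrite divr_ge0 ?ler_pdivrMr ?mul1r //; lra.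
have seg_ray (s : R) z : 0 <= s -> seg x (ray s) z -> exists2 t, 0 <= t <= s & z = ray t.
  move=> s0 [t /andP[t0 t1] ->]; exists (t * s); last by congr pair => /=; ring.
  by rewrite mulr_ge0 // ler_piMl.
have ray0 : ray 0 = x by rewrite /ray addr0; case: x {bd nbx ray_seg seg_ray ray}.
pose H := [set t : R | 0 <= t /\ pboundary vs (ray t)].
have comp (s : R) : 0 <= s -> (forall t, 0 <= t <= s -> ~ H t) ->
    connected_component (~` pboundary vs) x (ray s).
  move=> s0 nH; exists (seg x (ray s)); last exact: segr.
  split; [exact: segl| |exact: seg_connected].
  by move=> z /(seg_ray _ _ s0)[t ts ->] bz; apply: (nH t ts); split=> //; case/andP: ts.
have [H0|/set0P[t1 [t1ge Ht1]]] := eqVneq H set0.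
  have [M HM] := bd; exfalso.
  (* If the ray never hits the boundary, this parameter takes it past abscissa [M] within the
     bounded component. *)
  have := HM _ (comp (`|M| + `|x.1| + 1) _ _); rewrite H0.
  case=> [|t _ []|/= + _]; first by rewrite !addr_ge0.
  by have := ler_norm M; have := ler_norm (- x.1); rewrite normrN;
     have := ler_norm (x.1 + (`|M| + `|x.1| + 1)); lra.
have lbH : has_lbound H by exists 0 => t [].
have infH0 : 0 <= inf H by apply: lb_le_inf; [exists t1|move=> t []].
have Hcl : closed H.
  have -> : H = [set t | 0 <= t] `&` (ray @^-1` pboundary vs) by [].
  apply: closedI; first exact: closed_ge.
  apply: preimage_closed; last exact: pboundary_closed.
  move=> t _; have cvgx : x.1 + u @[u --> t] --> x.1 + t.
    by apply: cvgD; [exact: cvg_cst|exact: cvg_id].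
  have cvgy : (fun=> x.2) u @[u --> t] --> x.2 by exact: cvg_cst.
  exact: (cvg_pair cvgx cvgy).
have Hinf : H (inf H).
  apply: Hcl => B /nbhs_ballP[e e0 sub].
  have [|h Hh lt] := @inf_adherent _ H e e0; first by split=> //; exists t1.
  exists h; split=> //; apply: sub; rewrite /ball /= ltr_distlC.
  by have := ge_inf lbH Hh; move: e0 lt => /=; lra.
exists (ray (inf H)); first by case: Hinf.
exists [::]; split=> // z /(seg_ray _ _ infH0)[t /andP[t0 ti] ->].
have [->|tn] := eqVneq t (inf H); first by left; case: Hinf.
have lt : t < inf H by rewrite lt_neqAle tn.
have nH u : u <= t -> ~ H u.
  by move=> ut Hu; have := ge_inf lbH Hu; lra.
right; split; first by move=> b; apply: (nH t).
have cx : connected_component (~` pboundary vs) x (ray t).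
  by apply: comp => // u /andP[_ /nH].
by rewrite -(same_connected_component cx).
Qed.

Lemma pboundary_polyconn vs x y : pboundary vs x -> pboundary vs y ->
  polyconn (region vs) x y.
Proof.
have edge_region i : (i < size vs)%N -> edge vs i `<=` region vs.
  by move=> i_lt z ez; left; exists i.
have to_vtx i z : (i < size vs)%N -> edge vs i z -> polyconn (region vs) (vtx vs i) z.
  move=> i_lt ez; exists [::]; split=> //.
  exact: subset_trans (seg_subl ez) (edge_region _ i_lt).
have from0 i : (i < size vs)%N -> polyconn (region vs) (vtx vs 0) (vtx vs i).
  elim: i => [|i IH] i_lt; first by apply: to_vtx => //; exact: segl.
  apply: polyconn_trans (IH (ltnW i_lt)) _; apply: to_vtx (ltnW i_lt) _.
  exact: segr.
move=> [i i_lt ei] [j j_lt ej].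
apply: polyconn_trans (polyconn_trans (from0 j j_lt) (to_vtx _ _ j_lt ej)).
apply: polyconn_sym.
exact: polyconn_trans (from0 i i_lt) (to_vtx _ _ i_lt ei).
Qed.

(** Guarantees that [gdist] is an infimum over a nonempty set, as [gdist_approx] and the triangle
    inequality require. *)
Lemma region_polyconn vs x y : region vs x -> region vs y ->
  polyconn (region vs) x y.
Proof.
move=> /region_polyconn_boundary[x' bx' cx] /region_polyconn_boundary[y' by' cy].
apply: polyconn_trans cx (polyconn_trans (pboundary_polyconn bx' by') _).
exact: polyconn_sym.
Qed.
End RegionConnected.

(** * Delaunay pairs *)

Section DelaunayGraph.
Variables (R : realType) (P : set (pt R)) (T : finType) (pos : T -> pt R).
Hypothesis P_conn : forall x y, P x -> P y -> polyconn P x y.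
Hypothesis pos_in : forall u, P (pos u).
Implicit Types V : {set T}.

Definition delaunay V : rel T := fun u v =>
  `[< exists c, [/\ P c, gdist P c (pos u) = gdist P c (pos v) &
       {in V, forall w, w != u -> w != v -> gdist P c (pos u) < gdist P c (pos w)}] >].

Lemma delaunay_sym V : symmetric (delaunay V).
Proof.
have imp u v : delaunay V u v -> delaunay V v u.
  move=> /asboolP[c [Pc e far]]; apply/asboolP; exists c; split=> // w wV wv wu.
  by rewrite -e far.
by move=> u v; apply/idP/idP; exact: imp.
Qed.

(** Finitely many strict inequalities leave a common slack, which nearly shortest chains will
    use. *)
Lemma common_gap (r : R) (f : T -> R) (D : pred T) :
  (forall w, D w -> r < f w) -> exists2 l, r < l & forall w, D w -> l < f w.
Proof.
move=> h; suff [l rl lP] : exists2 l, r < l & forall w, w \in enum T -> D w -> l < f w.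
  by exists l => // w Dw; apply: lP => //; rewrite mem_enum.
elim: (enum T) => [|w s [l rl lP]]; first by exists (r + 1); rewrite ?ltrDl.
have [Dw|nDw] := boolP (D w); last first.
  by exists l => // z; rewrite inE => /predU1P[-> Dw|]; [rewrite Dw in nDw|exact: lP].
have rw := h w Dw; exists (Num.min l ((r + f w) / 2)).
  by rewrite lt_min rl /=; lra.
move=> z; rewrite inE => /predU1P[-> _|zs Dz].
  by rewrite gt_min; apply/orP; right; lra.
by rewrite gt_min lP.
Qed.

(* The two half-edges at the centre of an empty disk stay within radius
   [l], which is smaller than the distance to every other site. If two
   independent edges met at [z], the site nearer to [z] would lie in the disk of
   the other edge. *)
Lemma delaunay_drawable V : drawable pos V (delaunay V).
Proof.
have /choice[f fP] : forall p : T * T, exists cl : pt R * R, delaunay V p.1 p.2 ->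
    [/\ P cl.1, gdist P cl.1 (pos p.1) < cl.2, gdist P cl.1 (pos p.2) < cl.2 &
     {in V, forall w, w != p.1 -> w != p.2 -> cl.2 < gdist P cl.1 (pos w)}].
  move=> [u v] /=; have [/asboolP[c [Pc e far]]|nd] := boolP (delaunay V u v); last first.
    by exists (pos u, 0).
  have [|l rl lP] := @common_gap (gdist P c (pos u)) (gdist P c \o pos)
      [pred w | [&& w \in V, w != u & w != v]].
    by move=> w /and3P[wV wu wv]; exact: far.
  exists (c, l) => _; split=> //=; first by rewrite -e.
  by move=> w wV wu wv; apply: lP; rewrite /= wV wu.
pose arm u v x := ellipse P (f (u, v)).1 (pos x) (f (u, v)).2.
exists (fun u v => arm u v u `|` arm u v v); split.
  move=> u v uV vV uv Duv; have /= [Pc lu lv _] := fP (u, v) Duv.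
  apply: (@polyconn_trans _ _ _ (f (u, v)).1).
    apply: polyconn_sym.
    by apply: polyconn_sub (polyconn_ellipse (P_conn Pc (pos_in u)) lu) => z; left.
  by apply: polyconn_sub (polyconn_ellipse (P_conn Pc (pos_in v)) lv) => z; right.
move=> a b c d sV uabcd Dab Dcd; apply/seteqP; split=> // z [].
have [/= Pab la lb far_ab] := fP (a, b) Dab.
have [/= Pcd lc ld far_cd] := fP (c, d) Dcd.
have memV w : w \in [:: a; b; c; d] -> w \in V := sV w.
have clash x y : x \in [:: a; b] -> y \in [:: c; d] -> arm a b x z -> arm c d y z -> False.
  move=> xab ycd [Pz hx] [_ hy].
  have tri u x' : P u -> gdist P u (pos x') <= gdist P u z + gdist P z (pos x').
    by move=> Pu; apply: gdist_triangle; exact: P_conn.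
  have dis : (x != c) && (x != d) && (y != a) && (y != b).
    move: uabcd xab ycd; rewrite /= !inE !negb_or.
    case/and4P=> /and3P[ab ac ad] /andP[bc bd] cd _.
    by case/orP=> /eqP-> /orP[] /eqP->; rewrite ?ac ?ad ?bc ?bd /=
      ![_ == a]eq_sym ?[_ == b]eq_sym ?ac ?ad ?bc ?bd.
  move: dis => /andP[/andP[/andP[xc xd] ya] yb].
  have xV : x \in V by apply: memV; move: xab; rewrite !inE => /orP[] ->; rewrite ?orbT.
  have yV : y \in V by apply: memV; move: ycd; rewrite !inE => /orP[] ->; rewrite ?orbT.
  (* At the centre of ab the inequalities put [z] nearer to [x] than to [y]; at the centre of cd
     they give the reverse. *)
  have := far_cd x xV xc xd; have := far_ab y yV ya yb.
  have := tri _ x Pcd; have := tri _ y Pab; lra.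
by case=> h1 [h2|h2]; apply: (clash _ _ _ _ h1 h2); rewrite !inE eqxx ?orbT.
Qed.

Hypothesis pos_inj : injective pos.

(** Of 8 * 7 = 56 ordered pairs at most 6 * 8 - 12 = 36 are Delaunay. *)
Lemma delaunay_nonarcs V : #|V| = 8%N ->
  (20 <= #|arcs V (fun u v => ~~ delaunay V u v)|)%N.
Proof.
move=> cV; have := drawable_arcs_bound pos_inj (@delaunay_sym V) _ (delaunay_drawable V).
rewrite cV => /(_ isT).
by have := card_arcs_compl V (delaunay V); rewrite cV; lia.
Qed.
End DelaunayGraph.

(** * From Delaunay pairs to heavily covered pairs of sites *)

Theorem theorem2 (R : realType) (n : nat) : (8 <= n)%N ->
  forall (vs : seq (pt R)) (S : seq (pt R)),
    simple_polygon vs ->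
    uniq S -> size S = n -> (forall s, s \in S -> region vs s) ->
    general_position vs S ->
    exists u v, [/\ u \in S, v \in S, u != v &
      forall (c : pt R) (r : R), region vs c ->
        gdist (region vs) c u = r -> gdist (region vs) c v = r ->
        ((5 * (n - 2) + 83) %/ 84 <=
           count (fun s => (gdist (region vs) c s <= r)%R) S)%N].
Proof.
move=> n8 vs S _ uS sS SP _; apply: contrapT => no.
set P := region vs in no *; set K := (_ %/ 84)%N in no.
pose pos (i : 'I_n) : pt R := nth (pt0 R) S i.
have posS i : pos i \in S by rewrite mem_nth ?sS.
have pos_inj : injective pos.
  by move=> i j /eqP; rewrite nth_uniq ?sS // => /eqP; exact: ord_inj.
have countS (p : pred (pt R)) : count p S = #|[set i | p (pos i)]%SET|.
  have -> : S = map pos (enum 'I_n).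
    apply: (@eq_from_nth _ (pt0 R)); first by rewrite size_map size_enum_ord.
    move=> i; rewrite sS => i_lt.
    by rewrite (nth_map (Ordinal i_lt)) ?size_enum_ord // /pos nth_enum_ord.
  by rewrite -sum1_count big_map big_enum_cond sum1_card /= cardsE.
have P_conn x y : P x -> P y -> polyconn P x y := @region_polyconn R vs x y.
(* Under the negated conclusion, [f] selects for each pair the centre of a disk with fewer than [K]
   sites; on the diagonal its value is arbitrary. *)
have /choice[f fP] : forall p : 'I_n * 'I_n, exists c, p.1 != p.2 ->
    [/\ P c, gdist P c (pos p.1) = gdist P c (pos p.2) &
     (count (fun s => (gdist P c s <= gdist P c (pos p.1))%R) S < K)%N].
  move=> [u v] /=; have [uv|uv] := boolP (u != v); last by exists (pos u).
  apply: contrapT => h; apply: no; exists (pos u), (pos v); split=> //.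
    by apply: contraNneq uv => /pos_inj ->.
  move=> c r Pc eu ev; rewrite leqNgt; apply/negP=> lt; apply: h; exists c => _.
  by rewrite eu ev.
pose W u v := [set w : 'I_n | [&& w != u, w != v &
  gdist P (f (u, v)) (pos w) <= gdist P (f (u, v)) (pos u)]]%SET.
(* The 3 accounts for [u] and [v], which lie in the disk, and for the strict inequality. *)
have Wle u v : u != v -> (#|W u v| + 3 <= K)%N.
  move=> uv; have [_ e] := fP (u, v) uv; rewrite countS => lt.
  apply: leq_trans lt; rewrite addn3 ltnS.
  have -> : #|W u v|.+2 = #|(u |: (v |: W u v))%SET|.
    by rewrite !cardsU1 !inE !eqxx (negPf uv) andbF.
  apply/subset_leq_card/fintype.subsetP=> w; rewrite !inE /=.
  by case/or3P=> [/eqP->|/eqP->|/and3P[]]; rewrite -?e.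
(* Rounding up gives 84 K <= 5(n-2) + 83, which this inequality contradicts; should [K - 3] truncate
   to 0, n >= 8 does. *)
have : (5 * (#|'I_n| - 2) <= 84 * (K - 3))%N; last first.
  rewrite card_ord /K; lia.
apply: (@average_over_8_subsets _ W).
- by move=> u v /Wle; lia.
- by move=> u v; rewrite !inE !eqxx andbF.
- by rewrite card_ord.
move=> V cV.
have posP i : P (pos i) by exact: SP.
apply: leq_trans (delaunay_nonarcs P_conn posP pos_inj cV) _.
apply/subset_leq_card/fintype.subsetP=> -[u v]; rewrite !in_arcs.
(* If the selected disk held no further site of [V], its centre would witness that the pair is
   Delaunay. *)
case/and4P=> -> -> uv nD; rewrite uv /=; apply: contraNneq nD => W0.
have [Pc e _] := fP (u, v) uv.
apply/asboolP; exists (f (u, v)); split=> // w wV wu wv.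
rewrite ltNge; apply/negP=> le.
by have : w \in (W u v :&: V)%SET; [rewrite !inE wu wv le|rewrite W0 inE].
Qed.
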